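(* Let $t_1, t_2 \in \mathsf{Topo}$ such that each node in $t_1$ has at most $d$ children. There is a polynomial-time algorithm to determine whether $t_1$ embeds in $t_2$, and to find such an embedding if so.
   Context: Topologies: $\mathsf{Topo}$ is the smallest set with $* \in \mathsf{Topo}$ and $\mathsf{Node}(\vec t) \in \mathsf{Topo}$ for every $n \in \mathbb{N}$ and list $\vec t \in \mathsf{Topo}^n$ (a node with children $\vec t[1],\dots,\vec t[n]$). Addresses: $\mathsf{Addr}(t) \subseteq \mathbb{N}^*$ is the smallest set with $\epsilon \in \mathsf{Addr}(t)$ and $i\cdot\alpha \in \mathsf{Addr}(\mathsf{Node}(\vec t))$ for $1\le i\le n$, $\alpha\in\mathsf{Addr}(\vec t[i])$. Subtrees: $t/\epsilon = t$, $\mathsf{Node}(\vec t)/(i\cdot\alpha) = \vec t[i]/\alpha$. An embedding of $t_1$ in $t_2$ is an injective map $f:\mathsf{Addr}(t_1)\to\mathsf{Addr}(t_2)$ such that $f(\epsilon)=\epsilon$; $t_2/f(\alpha) = *$ whenever $t_1/\alpha = *$; and for all $\alpha,\alpha'$, $\alpha$ is a prefix of $\alpha'$ iff $f(\alpha)$ is a prefix of $f(\alpha')$. *)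

(* Defs.v *)
From mathcomp Require Import all_boot.
Set Implicit Arguments. Unset Strict Implicit. Unset Printing Implicit Defensive.

Inductive Topo : Type := Leaf : Topo | Node : seq Topo -> Topo.

(* Addresses are sequences of natural numbers; child indices are 1-based.
   subtree t a = Some (t / a) if a is an address of t, None otherwise. *)
Fixpoint subtree (t : Topo) (a : seq nat) {struct a} : option Topo :=
  match a with
  | [::] => Some t
  | i :: a' =>
      match t with
      | Leaf => None
      | Node ts =>
          if (0 < i) && (i <= size ts) then subtree (nth Leaf ts i.-1) a'
          else None
      end
  end.

Definition Addr (t : Topo) (a : seq nat) : Prop := subtree t a <> None.

Definition is_embedding (t1 t2 : Topo) (f : seq nat -> seq nat) : Prop :=
  [/\ (forall a, Addr t1 a -> Addr t2 (f a)),
      (forall a b, Addr t1 a -> Addr t1 b -> f a = f b -> a = b),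
      f [::] = [::],
      (forall a, subtree t1 a = Some Leaf -> subtree t2 (f a) = Some Leaf)
    & (forall a b, Addr t1 a -> Addr t1 b ->
         (prefix a b <-> prefix (f a) (f b)))].

Definition embeds (t1 t2 : Topo) : Prop := exists f, is_embedding t1 t2 f.

Fixpoint deg_le (d : nat) (t : Topo) : bool :=
  match t with
  | Leaf => true
  | Node ts => (size ts <= d) &&
      (fix go (us : seq Topo) : bool :=
         match us with [::] => true | u :: us' => deg_le d u && go us' end) ts
  end.

Fixpoint addrs (t : Topo) : seq (seq nat) :=
  match t with
  | Leaf => [:: [::]]
  | Node ts => [::] ::
      (fix go (i : nat) (us : seq Topo) : seq (seq nat) :=
         match us with
         | [::] => [::]
         | u :: us' => map (cons i) (addrs u) ++ go i.+1 us'
         end) 1 ts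
  end.

Definition list_fun (t1 : Topo) (L : seq (seq nat)) (a : seq nat) : seq nat :=
  nth [::] L (index a (addrs t1)).

Inductive sym : Type := Blank | SLeaf | SOpen | SClose | SSep | SOne | SZero.
Inductive move : Type := MoveL | MoveR | Stay.

(* finitely many states 'I_nst; trans = None means halt *)
Record TM : Type := MkTM {
  nst : nat;
  start : 'I_nst;
  trans : 'I_nst -> sym -> option ('I_nst * sym * move) }.

(* tape: (cells left of head, nearest first; head cell; cells right of head) *)
Definition tape := (seq sym * sym * seq sym)%type.

Definition move_tape (m : move) (tp : tape) : tape :=
  let: (l, h, r) := tp in
  match m with
  | Stay => tp
  | MoveL => match l with [::] => ([::], Blank, h :: r)
                         | x :: l' => (l', x, h :: r) end
  | MoveR => match r with [::] => (h :: l, Blank, [::])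
                         | x :: r' => (h :: l, x, r') end
  end.

Definition config (M : TM) := ('I_(nst M) * tape)%type.

Fixpoint exec (M : TM) (n : nat) (c : config M) : option (config M) :=
  let: (q, (l, h, r)) := c in
  match trans q h with
  | None => Some c
  | Some (q', s, m) =>
      match n with
      | 0 => None
      | n'.+1 => exec n' (q', move_tape m (l, s, r))
      end
  end.

Definition init_tape (w : seq sym) : tape :=
  match w with [::] => ([::], Blank, [::]) | a :: w' => ([::], a, w') end.

Definition init (M : TM) (w : seq sym) : config M := (start M, init_tape w).

Fixpoint take_nonblank (s : seq sym) : seq sym :=
  match s with
  | [::] => [::]
  | Blank :: _ => [::]
  | x :: s' => x :: take_nonblank s'
  end.

Definition output (M : TM) (c : config M) : seq sym :=
  let: (_, (_, h, r)) := c in take_nonblank (h :: r).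

Fixpoint code (t : Topo) : seq sym :=
  match t with
  | Leaf => [:: SLeaf]
  | Node ts => SOpen ::
      (fix go (us : seq Topo) : seq sym :=
         match us with [::] => [::] | u :: us' => code u ++ go us' end) ts
      ++ [:: SClose]
  end.

Definition input (t1 t2 : Topo) : seq sym := code t1 ++ SSep :: code t2.

Definition enc_addr (a : seq nat) : seq sym :=
  flatten (map (fun i => nseq i SOne ++ [:: SSep]) a) ++ [:: SClose].

Definition enc_no : seq sym := [:: SZero].
Definition enc_yes (L : seq (seq nat)) : seq sym := SLeaf :: flatten (map enc_addr L).

(* Main.v *)
Require Import Defs.
From HB Require Import structures.
From mathcomp Require Import all_boot.
From mathcomp Require Import zify.

(** The images of the children of a node only have to be pairwise incomparable
    proper descendants of the image of the node, and whether a subtree of t1 embeds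
    at a given address of t2 does not depend on the rest of the embedding. Working
    upwards in t1, one therefore keeps, for every node of t1 and every address of t2,
    at most one embedding of the subtree at that address. At a node with k children
    it suffices to try all choices of one embedding per child, which are at most
    |t2|^k <= |t2|^d in number.

    To obtain a Turing machine, the algorithm is written with folds over binary
    trees. Trees in Polish notation are stored on a stack, four stacks are stored one
    after the other on the tape, and each operation on a stack shifts a part of the
    tape by one cell. A fold takes polynomial time as soon as its accumulators have
    polynomial size: for most folds this holds because the growth of the accumulator
    is independent of its value, for the main one because of the degree bound. *)

Set Implicit Arguments. Unset Strict Implicit. Unset Printing Implicit Defensive.

(** * Turing machines from structured tape programs *)

(** The only loop available on trees is a fold along a list. The recursion on [t1] therefore becomes
    a pass over its code from right to left with an explicit stack, and [t1] is never rebuilt as a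
    tree; [t2] enters only as the list of its node addresses with their kinds. Reading from the
    right delivers children from last to first, so prepending image lists yields the order of
    [addrs t1] that [list_fun] expects. Only the root, the leaves and the prefix relation have to be
    controlled: injectivity follows, since prefix is antisymmetric. The obstacle is the main fold,
    where one step can multiply the number of stored items, so no bound per step is available. Its
    accumulators are bounded along the actual run instead: each stack entry is the item list of an
    explicit list of at most [d.+1] trees, and soundness of these items bounds their size. The
    program itself does not mention [d]; the degree bound enters only the polynomial. *)

Definition sym_index (s : sym) : nat :=
  match s with
  | Blank => 0 | SLeaf => 1 | SOpen => 2 | SClose => 3
  | SSep => 4 | SOne => 5 | SZero => 6
  end.

Definition all_syms : seq sym := [:: Blank; SLeaf; SOpen; SClose; SSep; SOne; SZero].

Lemma sym_indexK : cancel sym_index (nth Blank all_syms).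
Proof. by case. Qed.

Definition sym_eqb (s t : sym) : bool := sym_index s == sym_index t.

Lemma sym_eqP : Equality.axiom sym_eqb.
Proof. by move=> s t; apply: (iffP eqP) => [/(can_inj sym_indexK)|->]. Qed.

HB.instance Definition _ := hasDecEq.Build sym sym_eqP.
HB.instance Definition _ := CanIsCountable sym_indexK.

Lemma all_symsP : Finite.axiom all_syms.
Proof. by case. Qed.

HB.instance Definition _ := isFinite.Build sym all_symsP.

(* A finite memory of two symbols: the first is the register of the stack
   language below, the second is the carry used when the tape is shifted. *)
Definition memory : Type := (sym * sym)%type.

Inductive tprog :=
| TAct of (memory -> sym -> memory * sym * move)
| TSeq of tprog & tprog
| TIf of (memory -> sym -> bool) & tprog & tprog
| TWhile of (memory -> sym -> bool) & tprog.

Definition tstate := (memory * tape)%type.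

Definition scan (x : tstate) : sym := x.2.1.2.

Definition act_on (f : memory -> sym -> memory * sym * move) (x : tstate) : tstate :=
  let: (v, (l, h, r)) := x in
  let: (v', s, m) := f v h in (v', move_tape m (l, s, r)).

(* [trun p x n y]: from [x], the program [p] ends in [y] within [n] steps. *)
Inductive trun : tprog -> tstate -> nat -> tstate -> Prop :=
| RunAct f x n : 0 < n -> trun (TAct f) x n (act_on f x)
| RunSeq p q x y z n1 n2 n : trun p x n1 y -> trun q y n2 z -> n1 + n2 <= n ->
    trun (TSeq p q) x n z
| RunIf (b : memory -> sym -> bool) p q x y n1 n : trun (if b x.1 (scan x) then p else q) x n1 y ->
    n1 < n -> trun (TIf b p q) x n y
| RunWhileF (b : memory -> sym -> bool) p x n : b x.1 (scan x) = false -> 0 < n -> trun (TWhile b p) x n x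
| RunWhileT (b : memory -> sym -> bool) p x y z n1 n2 n : b x.1 (scan x) -> trun p x n1 y ->
    trun (TWhile b p) y n2 z -> n1 + n2 < n -> trun (TWhile b p) x n z.

Fixpoint tstates (p : tprog) : finType :=
  match p with
  | TAct _ => unit
  | TSeq p q => (tstates p + tstates q)%type
  | TIf _ p q => option (tstates p + tstates q)%type
  | TWhile _ p => option (tstates p)
  end.

Fixpoint tstart (p : tprog) : tstates p :=
  match p with
  | TAct _ => tt
  | TSeq p q => inl (tstart p)
  | TIf _ p q => None
  | TWhile _ p => None
  end.

(* A missing successor state means that the program has ended. *)
Fixpoint ttrans (p : tprog) : tstates p -> memory -> sym ->
    option (tstates p) * (memory * sym * move) :=
  match p return tstates p -> memory -> sym ->
    option (tstates p) * (memory * sym * move) with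
  | TAct f => fun _ v s => (None, f v s)
  | TSeq p q => fun x v s =>
      match x with
      | inl x => let: (o, a) := ttrans x v s in
          (Some (if o is Some y then inl y else inr (tstart q)), a)
      | inr x => let: (o, a) := ttrans x v s in (omap inr o, a)
      end
  | TIf b p q => fun x v s =>
      match x with
      | None => (Some (Some (if b v s then inl (tstart p) else inr (tstart q))),
                 (v, s, Stay))
      | Some (inl x) => let: (o, a) := ttrans x v s in
          (omap (fun y => Some (inl y)) o, a)
      | Some (inr x) => let: (o, a) := ttrans x v s in
          (omap (fun y => Some (inr y)) o, a)
      end
  | TWhile b p => fun x v s =>
      match x with
      | None => (if b v s then Some (Some (tstart p)) else None, (v, s, Stay))
      | Some x => let: (o, a) := ttrans x v s in (Some o, a)
      end
  end.

Definition tconfig p : Type := (option (tstates p) * tstate)%type.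

Definition tstep p (c : tconfig p) : tconfig p :=
  let: (o, (v, (l, h, r))) := c in
  match o with
  | None => c
  | Some x => let: (o', (v', s, m)) := ttrans x v h in
              (o', (v', move_tape m (l, s, r)))
  end.

Lemma iter_tstep_end p n y : iter n (@tstep p) (None, y) = (None, y).
Proof. by elim: n => //= n ->; case: y => v [[l h] r]. Qed.

(* [e] is the state that [q] enters when its component [p] ends. *)
Lemma iter_tstep_embed p q (inj : tstates p -> tstates q) (e : option (tstates q)) :
  (forall x v s, @ttrans q (inj x) v s =
     (if (ttrans x v s).1 is Some y then Some (inj y) else e, (ttrans x v s).2)) ->
  forall n x s y, iter n (@tstep p) (Some x, s) = (None, y) ->
  exists2 m, m <= n & iter m (@tstep q) (Some (inj x), s) = (e, y).
Proof.
move=> Hinj; elim=> [|n IHn] x s y //; rewrite iterSr.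
case: s => v [[l h] r] /=.
move: (Hinj x v h); case: (ttrans x v h) => [o [[v' s] m]] /= E.
case: o E => [x'|] E H.
  have [k lk Hk] := IHn _ _ _ H.
  by exists k.+1 => //; rewrite iterSr /= E.
exists 1 => //=; rewrite E; congr pair.
by move: H; rewrite iter_tstep_end => -[].
Qed.

Lemma tstep_add p m n (c c' c'' : tconfig p) :
  iter m (@tstep p) c = c' -> iter n (@tstep p) c' = c'' ->
  iter (m + n) (@tstep p) c = c''.
Proof. by move=> <- <-; rewrite addnC iterD. Qed.

Lemma tstep_le p m n (c : tconfig p) y :
  iter m (@tstep p) c = (None, y) -> m <= n -> iter n (@tstep p) c = (None, y).
Proof. by move=> H le; rewrite -(subnK le) iterD H iter_tstep_end. Qed.

(** The states of a component embed in those of the compound program, so its run is replayed there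
    and ends in the start state of the next component. The strict inequalities of [trun] for tests
    pay for the one step that evaluates the condition. *)
Lemma trun_iter p x n y : trun p x n y ->
  iter n (@tstep p) (Some (tstart p), x) = (None, y).
Proof.
elim=> {p x n y}.
- move=> f [v [[l h] r]] [//|n] _; rewrite iterSr /=.
  by case: (f v h) => [[v' s] m]; rewrite iter_tstep_end.
- move=> p q x y z n1 n2 n _ H1 _ H2 le.
  have [|m1 l1 E1] := @iter_tstep_embed p (TSeq p q) inl (Some (inr (tstart q))) _ _ _ _ _ H1.
    by move=> t v s /=; case: (ttrans t v s) => [[]].
  have [|m2 l2 E2] := @iter_tstep_embed q (TSeq p q) inr None _ _ _ _ _ H2.
    by move=> t v s /=; case: (ttrans t v s) => [[]].
  by apply: (tstep_le (tstep_add E1 E2)); lia.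
- move=> b p q [v [[l h] r]] y n1 n /=; rewrite /scan /= => _ H lt.
  have E0 : iter 1 (@tstep (TIf b p q)) (Some (tstart (TIf b p q)), (v, (l, h, r)))
    = (Some (Some (if b v h then inl (tstart p) else inr (tstart q))), (v, (l, h, r))) by [].
  case: (b v h) H E0 => H E0.
    have [|m1 l1 E1] := @iter_tstep_embed p (TIf b p q) (fun x => Some (inl x)) None _ _ _ _ _ H.
      by move=> t w s /=; case: (ttrans t w s) => [[]].
    by apply: (tstep_le (tstep_add E0 E1)); lia.
  have [|m1 l1 E1] := @iter_tstep_embed q (TIf b p q) (fun x => Some (inr x)) None _ _ _ _ _ H.
    by move=> t w s /=; case: (ttrans t w s) => [[]].
  by apply: (tstep_le (tstep_add E0 E1)); lia.
- move=> b p [v [[l h] r]] n /=; rewrite /scan /= => H lt.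
  by apply: (@tstep_le (TWhile b p) 1) => //=; rewrite H.
- move=> b p [v [[l h] r]] y z n1 n2 n /=; rewrite /scan /= => Hb _ H1 _ H2 lt.
  have E0 : iter 1 (@tstep (TWhile b p)) (Some (tstart (TWhile b p)), (v, (l, h, r)))
    = (Some (Some (tstart p)), (v, (l, h, r))) by rewrite /= Hb.
  have [|m1 l1 E1] := @iter_tstep_embed p (TWhile b p) Some (Some None) _ _ _ _ _ H1.
    by move=> t w s /=; case: (ttrans t w s) => [[]].
  by apply: (tstep_le (tstep_add (tstep_add E0 E1) H2)); lia.
Qed.

(** The finite memory becomes part of the control state; [enum_rank] numbers the resulting finite
    type by the ordinals that [TM] asks for. *)
Definition TM_of (p : tprog) : TM :=
  let Q : finType := (option (tstates p) * memory)%type in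
  @MkTM #|Q| (enum_rank ((Some (tstart p), (Blank, Blank)) : Q))
    (fun q s =>
       let: (o, v) := (enum_val q : Q) in
       if o is Some x then
         let: (o', (v', s', m)) := ttrans x v s in
         Some (enum_rank ((o', v') : Q), s', m)
       else None).

Definition TM_config p (c : tconfig p) : config (TM_of p) :=
  (enum_rank ((c.1, c.2.1) : (option (tstates p) * memory)%type), c.2.2).

Lemma exec_iter p n (c : tconfig p) y :
  iter n (@tstep p) c = (None, y) ->
  exec n (TM_config c) = Some (TM_config (None, y)).
Proof.
elim: n c => [|n IHn] [o [v [[l h] r]]].
  by case=> -> <-; rewrite /= enum_rankK.
rewrite iterSr => H; rewrite /= enum_rankK.
case: o H => [x|] /=.
  case E: (ttrans x v h) => [o' [[v' s'] m]] H.
  by rewrite -(IHn _ H).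
by rewrite iter_tstep_end => -[<-].
Qed.

Lemma TM_of_exec p n w v tp :
  trun p ((Blank, Blank), init_tape w) n (v, tp) ->
  exec n (init (TM_of p) w) = Some (TM_config (None : option (tstates p), (v, tp))).
Proof. by move/trun_iter/exec_iter. Qed.

(** * A single tape as a list of stacks *)

Definition zip_tape (l s : seq sym) : tape := (l, head Blank s, behead s).

(** The result of moving left from [zip_tape l s] when [s] is nonempty: the head stands on the last
    cell before [s]. *)
Definition left_of (l s : seq sym) : tape := zip_tape (behead l) (head Blank l :: s).

Lemma trun_le p x n y m : trun p x n y -> n <= m -> trun p x m y.
Proof.
move=> H; case: H m => {p x n y}.
- by move=> f x n lt m le; apply: RunAct; lia.
- by move=> p q x y z n1 n2 n H1 H2 lt m le; apply: RunSeq H1 H2 _; lia.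
- by move=> b p q x y n1 n H1 lt m le; apply: RunIf H1 _; lia.
- by move=> b p x n H lt m le; apply: RunWhileF => //; lia.
- by move=> b p x y z n1 n2 n Hb H1 H2 lt m le; apply: (RunWhileT Hb H1 H2); lia.
Qed.

Lemma trun_act f x y n : act_on f x = y -> 0 < n -> trun (TAct f) x n y.
Proof. by move=> <- lt; apply: RunAct. Qed.

Definition tmove (m : move) := TAct (fun v s => (v, s, m)).
Definition tnop := tmove Stay.
Definition tset (f : memory -> sym -> memory) := TAct (fun v s => (f v s, s, Stay)).
Definition tput := TAct (fun v s => (v, v.2, Stay)).
Definition tswap (m : move) := TAct (fun v s => ((v.1, s), v.2, m)).

Definition rewind :=
  TSeq (TWhile (fun _ s => s != Blank) (tmove MoveL)) (tmove MoveR).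
Definition shift_left :=
  TSeq (TWhile (fun _ s => s != Blank) (tswap MoveL)) tput.

Fixpoint pass_seps (step : tprog) (i : nat) : tprog :=
  if i is i'.+1 then
    TSeq (TSeq (TWhile (fun _ s => s != SZero) step) step) (pass_seps step i')
  else tnop.

Notation nonblank := (fun s : sym => s != Blank).
Notation stack_sym := (fun s : sym => (s != Blank) && (s != SZero)).

(** The walk stops on the first blank to the left and steps back. For [m = 0] it leaves the
    represented part of the tape, which creates one blank; hence [m.-1.+1]. *)
Lemma rewind_run v q m s n :
  all nonblank q -> 2 * size q + 3 <= n ->
  trun rewind (v, left_of (q ++ nseq m Blank) s) n
              (v, zip_tape (nseq m.-1.+1 Blank) (rev q ++ s)).
Proof.
move=> Hq le.
have H : trun (TWhile (fun _ s => s != Blank) (tmove MoveL))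
    (v, left_of (q ++ nseq m Blank) s) (2 * size q + 1)
    (v, zip_tape (nseq m.-1 Blank) (Blank :: rev q ++ s)).
  elim: q s Hq {le} => [|x q IHq] s /=.
    by move=> _; case: m => [|m]; apply: RunWhileF.
  case/andP=> Hx Hq.
  apply: (@RunWhileT _ _ _ (v, left_of (q ++ nseq m Blank) (x :: s)) _ 1 (2 * size q + 1)) => //;
    last by lia.
    by apply: trun_act => //=; case: (q ++ _).
  by rewrite rev_cons cat_rcons; apply: IHq.
apply: (RunSeq H (n2 := 1)); last by lia.
by apply: trun_act => //=; case: (rev q ++ s).
Qed.

(** Each cell receives the carry and hands over its old symbol, so [q] moves one cell to the left
    and [c] takes the freed cell before [s]. The last carry overwrites the blank that ended the
    walk: the contents grow to the left, and the head is already at their left end. *)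
Lemma shift_left_run r c q m s n :
  all nonblank q -> 2 * size q + 3 <= n ->
  exists c', trun shift_left ((r, c), left_of (q ++ nseq m Blank) s) n
              ((r, c'), zip_tape (nseq m.-1 Blank) (rev q ++ c :: s)).
Proof.
move=> Hq le; exists (last c q).
have H : trun (TWhile (fun _ s => s != Blank) (tswap MoveL))
    ((r, c), left_of (q ++ nseq m Blank) s) (2 * size q + 1)
    ((r, last c q), zip_tape (nseq m.-1 Blank) (Blank :: behead (rev q ++ c :: s))).
  elim: q c s Hq {le} => [|x q IHq] c s /=.
    by move=> _; case: m => [|m]; apply: RunWhileF.
  case/andP=> Hx Hq.
  apply: (@RunWhileT _ _ _ ((r, x), left_of (q ++ nseq m Blank) (c :: s)) _ 1 (2 * size q + 1)) => //;
    last by lia.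
    by apply: trun_act => //=; case: (q ++ _).
  by rewrite rev_cons cat_rcons; apply: IHq.
apply: (RunSeq H (n2 := 1)); last by lia.
apply: trun_act => //=; rewrite /zip_tape /=; congr (_, (_, _, _)).
by case/lastP: q {Hq le H} => // q x; rewrite last_rcons rev_rcons.
Qed.

Definition flat (ss : seq (seq sym)) : seq sym := flatten [seq rcons s SZero | s <- ss].

Lemma flat_cat s1 s2 : flat (s1 ++ s2) = flat s1 ++ flat s2.
Proof. by rewrite /flat map_cat flatten_cat. Qed.

Lemma flat_cons s ss : flat (s :: ss) = s ++ SZero :: flat ss.
Proof. by rewrite /flat /= cat_rcons. Qed.

Lemma flat_nonblank ss : all (all stack_sym) ss -> all nonblank (flat ss).
Proof.
elim: ss => //= s ss IH /andP[Hs /IH Hss].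
rewrite flat_cons all_cat /= Hss andbT.
by apply: sub_all Hs => x /andP[].
Qed.

(* The two walks: plain moves to the right, and moves that shift the contents
   one cell to the right through the carry. *)
Lemma pass_seps_run (step : tprog) (f : memory -> sym -> memory) (g : memory -> sym -> sym) :
  (forall v l x s, trun step (v, zip_tape l (x :: s)) 1 (f v x, zip_tape (g v x :: l) s)) ->
  (forall ss v l s n, all (all stack_sym) ss -> 4 * size (flat ss) + 1 <= n ->
   exists (v' : memory) l', trun (pass_seps step (size ss)) (v, zip_tape l (flat ss ++ s)) n
      (v', zip_tape (l' ++ l) s) /\
   (v', rev l') = foldl (fun (w : memory * seq sym) x => (f w.1 x, rcons w.2 (g w.1 x)))
                        (v, [::]) (flat ss)).
Proof.
move=> Hstep ss.
set F := fun (w : memory * seq sym) x => (f w.1 x, rcons w.2 (g w.1 x)).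
have Facc v q t : foldl F (v, q) t = ((foldl F (v, [::]) t).1, q ++ (foldl F (v, [::]) t).2).
  elim: t v q => [|x t IH] v q /=; first by rewrite cats0.
  by rewrite IH [in RHS]IH /= -cats1 -catA.
elim: ss => [|s ss IH] v l t n Hall le.
  exists v, [::]; split; last by [].
  by apply: trun_act => //; lia.
move: Hall => /= /andP[Hs Hss].
have Hw : forall v l u, trun (TWhile (fun _ s => s != SZero) step) (v, zip_tape l (s ++ SZero :: u)) (2 * size s + 1)
    ((foldl F (v, [::]) s).1, zip_tape (rev (foldl F (v, [::]) s).2 ++ l) (SZero :: u)).
  move=> {}v {}l u; elim: s v l {le} Hs => [|x s IHs] v' l' /=.
    by move=> _; apply: RunWhileF.
  case/andP=> /andP[_ Hx] Hs.
  apply: (@RunWhileT _ _ _ _ _ 1 (2 * size s + 1) _ _ (Hstep _ _ _ _)) => //; last by lia.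
  have -> : foldl F (F (v', [::]) x) s =
    ((foldl F (f v' x, [::]) s).1, [:: g v' x] ++ (foldl F (f v' x, [::]) s).2) by rewrite -Facc.
  by rewrite rev_cat -catA; apply: IHs.
set w := foldl F (v, [::]) s in Hw.
set v1 := f w.1 SZero; set l1 := g w.1 SZero :: rev w.2 ++ l.
have [v' [l' [H E]]] := IH v1 l1 t (4 * size (flat ss) + 1) Hss (leqnn _).
exists v', (l' ++ g w.1 SZero :: rev w.2); split.
  rewrite flat_cons -catA /=.
  apply: (RunSeq (RunSeq (Hw _ _ _) (Hstep _ _ _ _) (leqnn _))).
    by rewrite -catA; apply: H.
  by move: le; rewrite flat_cons size_cat /=; lia.
rewrite flat_cons foldl_cat -/w /= [F w SZero]surjective_pairing Facc -/v1 -E /=.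
by rewrite rev_cat rev_cons revK /F /= -cats1 -!catA.
Qed.

Lemma walk_run ss v l s n : all (all stack_sym) ss -> 4 * size (flat ss) + 1 <= n ->
  trun (pass_seps (tmove MoveR) (size ss)) (v, zip_tape l (flat ss ++ s)) n
       (v, zip_tape (rev (flat ss) ++ l) s).
Proof.
move=> Hss le.
have [|v' [l' [H E]]] := @pass_seps_run (tmove MoveR) (fun v _ => v) (fun _ x => x) _
  ss v l s n Hss le.
  by move=> w k x [|y t]; apply: trun_act.
have {}E : (v', rev l') = (v, flat ss).
  rewrite E; elim/last_ind: (flat ss) => // t x IH.
  by rewrite foldl_rcons IH.
by case: E H => -> <-; rewrite revK.
Qed.

Lemma shift_run ss r c l s n : all (all stack_sym) ss -> 4 * size (flat ss) + 1 <= n ->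
  trun (pass_seps (tswap MoveR) (size ss)) ((r, c), zip_tape l (flat ss ++ s)) n
       ((r, last c (flat ss)), zip_tape (rev (belast c (flat ss)) ++ l) s).
Proof.
move=> Hss le.
have [|v' [l' [H E]]] := @pass_seps_run (tswap MoveR) (fun v x => (v.1, x)) (fun v _ => v.2) _
  ss (r, c) l s n Hss le.
  by move=> w k x [|y t]; apply: trun_act.
have {}E : (v', rev l') = ((r, last c (flat ss)), belast c (flat ss)).
  rewrite E; elim/last_ind: (flat ss) => // t x IH.
  by rewrite foldl_rcons IH /= last_rcons belast_rcons lastI.
by case: E H => -> <-; rewrite revK.
Qed.

(** Only the [i] stacks in front of the target move, by one cell to the left; nothing to the right
    of the insertion point changes. *)
Definition push_prog (i : nat) (g : sym -> sym) :=
  TSeq (TSeq (TSeq (tset (fun v _ => (v.1, g v.1))) (pass_seps (tmove MoveR) i))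
    (tmove MoveL)) shift_left.

(** Meeting the separator means that the stack is empty, which the register reports as [Blank].
    Otherwise the [i] stacks in front are shifted one cell to the right over the popped symbol; the
    carry starts as a blank, so a blank is left behind at the left end. *)
Definition pop_prog (i : nat) :=
  TSeq (TSeq (TSeq (pass_seps (tmove MoveR) i)
      (tset (fun v s => (if s == SZero then Blank else s, Blank)))) rewind)
    (TIf (fun v _ => v.1 != Blank)
       (TSeq (TSeq (pass_seps (tswap MoveR) i) tput) rewind) tnop).

Definition tape_of (m n : nat) (ss : seq (seq sym)) : tape :=
  zip_tape (nseq m Blank) (flat ss ++ nseq n Blank).

Lemma push_run pre s post g r c m n k :
  all (all stack_sym) pre ->
  10 * size (flat (pre ++ s :: post)) + 10 <= k ->
  exists c' m', trun (push_prog (size pre) g) ((r, c), tape_of m n (pre ++ s :: post)) k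
     ((r, c'), tape_of m' n (pre ++ (g r :: s) :: post)).
Proof.
move=> Hpre le.
set suf := s ++ SZero :: flat post ++ nseq n Blank.
have Hq : all nonblank (rev (flat pre)) by rewrite all_rev flat_nonblank.
have [c' H] := @shift_left_run r (g r) _ m suf (2 * size (flat pre) + 3) Hq
  ltac:(by rewrite size_rev).
exists c', m.-1.
have -> : tape_of m n (pre ++ s :: post) = zip_tape (nseq m Blank) (flat pre ++ suf).
  by rewrite /tape_of flat_cat flat_cons -!catA /=.
have -> : tape_of m.-1 n (pre ++ (g r :: s) :: post) =
    zip_tape (nseq m.-1 Blank) (rev (rev (flat pre)) ++ g r :: suf).
  by rewrite revK /tape_of flat_cat flat_cons -!catA /=.
have sz : size (flat pre) < size (flat (pre ++ s :: post)).
  by rewrite flat_cat flat_cons !size_cat /=; lia.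
apply: (RunSeq (RunSeq (RunSeq _ (walk_run _ _ _ Hpre (leqnn _)) (leqnn _)) _ (leqnn _)) H).
- by apply: (@trun_act _ _ _ 1).
- apply: (@trun_act _ _ _ 1) => //=.
  by rewrite /suf; case: (s) => [|??]; case: (rev _ ++ _).
- by lia.
Qed.

Lemma pop_run pre s post r c m n k :
  all (all stack_sym) pre -> all stack_sym s ->
  20 * size (flat (pre ++ s :: post)) + 30 <= k ->
  exists c' m', trun (pop_prog (size pre)) ((r, c), tape_of m n (pre ++ s :: post)) k
     ((head Blank s, c'), tape_of m' n (pre ++ behead s :: post)).
Proof.
move=> Hpre Hs le.
have Hq : all nonblank (rev (flat pre)) by rewrite all_rev flat_nonblank.
set rest := flat post ++ nseq n Blank.
set x := head SZero s; set suf := behead (s ++ SZero :: rest).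
have Ex : s ++ SZero :: rest = x :: suf by rewrite /x /suf; case: (s).
have E0 : tape_of m n (pre ++ s :: post) = zip_tape (nseq m Blank) (flat pre ++ x :: suf).
  by rewrite /tape_of flat_cat flat_cons -!catA /= Ex.
have Nx : x != Blank by rewrite /x; case: (s) Hs => //= y t /andP[/andP[]].
have H1 := walk_run (r, c) (nseq m Blank) (x :: suf) Hpre (leqnn _).
have H2 : trun (tset (fun v s => (if s == SZero then Blank else s, Blank)))
   ((r, c), zip_tape (rev (flat pre) ++ nseq m Blank) (x :: suf)) 1
   ((head Blank s, Blank), left_of (x :: rev (flat pre) ++ nseq m Blank) suf).
  apply: trun_act => //=; rewrite /left_of /=; congr (_, _, _).
  by rewrite /x; case: (s) Hs => //= y t /andP[/andP[_ /negbTE ->]].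
have H3 := @rewind_run (head Blank s, Blank) (x :: rev (flat pre)) m suf
   (2 * size (x :: rev (flat pre)) + 3) _ (leqnn _).
have {}H3 := H3 ltac:(by rewrite /= Nx).
have H12 := RunSeq (RunSeq H1 H2 (leqnn _)) H3 (leqnn _).
have sz : size (flat pre) < size (flat (pre ++ s :: post)).
  by rewrite flat_cat flat_cons !size_cat /=; lia.
rewrite /= size_rev in H12.
case: s Hs @x @suf le Ex E0 Nx {H1 H2 H3} H12 sz => [|y s] Hs x suf le Ex E0 Nx H12 sz.
  exists Blank, m.-1.+1; rewrite E0; apply: (RunSeq H12).
    apply: (@RunIf _ _ _ _ _ 1 2) => //=; apply: trun_act => //.
    rewrite /act_on /= /tape_of /=; congr (_, _).
    rewrite flat_cat flat_cons rev_cons revK cat_rcons -!catA /=.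
    by [].
  by lia.
have {}Ex : suf = s ++ SZero :: rest by [].
(* The first rewind leaves [m.-1.+1] blanks, and the blank carry of the shift adds one. The final
   carry is the symbol written over the popped cell. *)
exists (last Blank (flat pre)), (m.-1.+2).
rewrite E0; apply: (RunSeq H12).
  apply: (@RunIf _ _ _ _ _ (4 * size (flat pre) + 1 + 1 + (2 * size (flat pre) + 3)) _);
    last exact: leqnn.
  rewrite /= Nx.
  apply: (RunSeq (RunSeq _ _ (leqnn _)) _ (leqnn _)).
  - rewrite rev_cons revK cat_rcons.
    exact: (shift_run _ _ _ _ Hpre (leqnn _)).
  - by apply: trun_act.
  - have := @rewind_run (y, last Blank (flat pre)) _ (m.-1.+2) suf
     (2 * size (flat pre) + 3) Hq ltac:(by rewrite size_rev).
    rewrite revK /tape_of flat_cat flat_cons -!catA /= -/rest -Ex.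
    suff -> : left_of (rev (flat pre) ++ nseq m.-1.+2 Blank) suf =
      (rev (belast Blank (flat pre)) ++ nseq m.-1.+1 Blank, last Blank (flat pre), suf) by [].
    case/lastP: (flat pre) => //= t z.
    by rewrite rev_rcons belast_rcons last_rcons rev_cons cat_rcons.
by lia.
Qed.

(** * A language of four stacks and one register *)

Inductive stk := StkA | StkB | StkC | StkK.

Definition store : Type := (seq sym * seq sym * seq sym * seq sym)%type.

Definition get (i : stk) (s : store) : seq sym :=
  let: (a, b, c, k) := s in
  match i with StkA => a | StkB => b | StkC => c | StkK => k end.

Definition set (i : stk) (s : store) (x : seq sym) : store :=
  let: (a, b, c, k) := s in
  match i with
  | StkA => (x, b, c, k) | StkB => (a, x, c, k)
  | StkC => (a, b, x, k) | StkK => (a, b, c, x)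
  end.

Definition weight (s : store) : nat :=
  let: (a, b, c, k) := s in size a + size b + size c + size k.

Inductive sprog :=
| SPush of stk & (sym -> sym)
| SPop of stk
| SNop
| SSeq of sprog & sprog
| SIf of (sym -> bool) & sprog & sprog
| SWhile of (sym -> bool) & sprog.

(* [srun N p r s n r' s']: from register [r] and stacks [s], the program [p]
   ends in [r'], [s'] within [n] steps, with at most [N] symbols stored at any time. *)
Inductive srun (N : nat) : sprog -> sym -> store -> nat -> sym -> store -> Prop :=
| RunPush i (g : sym -> sym) r s n : g r != Blank -> g r != SZero -> weight s < N ->
    0 < n -> srun N (SPush i g) r s n r (set i s (g r :: get i s))
| RunPop i r s n : weight s <= N -> 0 < n ->
    srun N (SPop i) r s n (head Blank (get i s)) (set i s (behead (get i s)))
| RunNop r s n : 0 < n -> srun N SNop r s n r s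
| RunSSeq p q r s r1 s1 r2 s2 n1 n2 n : srun N p r s n1 r1 s1 ->
    srun N q r1 s1 n2 r2 s2 -> n1 + n2 <= n -> srun N (SSeq p q) r s n r2 s2
| RunSIf (b : sym -> bool) p q r s r1 s1 n1 n :
    srun N (if b r then p else q) r s n1 r1 s1 -> n1 < n -> srun N (SIf b p q) r s n r1 s1
| RunSWhileF (b : sym -> bool) p r s n : b r = false -> 0 < n ->
    srun N (SWhile b p) r s n r s
| RunSWhileT (b : sym -> bool) p r s r1 s1 r2 s2 n1 n2 n : b r ->
    srun N p r s n1 r1 s1 -> srun N (SWhile b p) r1 s1 n2 r2 s2 ->
    n1 + n2 < n -> srun N (SWhile b p) r s n r2 s2.

Definition stk_index (i : stk) : nat :=
  match i with StkA => 0 | StkB => 1 | StkC => 2 | StkK => 3 end.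

Fixpoint tprog_of (p : sprog) : tprog :=
  match p with
  | SPush i g => push_prog (stk_index i) g
  | SPop i => pop_prog (stk_index i)
  | SNop => tnop
  | SSeq p q => TSeq (tprog_of p) (tprog_of q)
  | SIf b p q => TIf (fun v _ => b v.1) (tprog_of p) (tprog_of q)
  | SWhile b p => TWhile (fun v _ => b v.1) (tprog_of p)
  end.

Definition stacks (s : store) : seq (seq sym) :=
  let: (a, b, c, k) := s in [:: a; b; c; k].

Lemma size_flat_stacks s : size (flat (stacks s)) = weight s + 4.
Proof. by case: s => [[[a b] c] k]; rewrite /flat /= !size_cat !size_rcons /=; lia. Qed.

(** With its four separators a store of at most [N] symbols fills at most [N + 4] cells, and the
    cost [20 * _ + 30] of the dearest operation, a pop, becomes [20 * N + 110] per step. The final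
    carry and the number of blanks on the left stay existential: every operation resets the carry
    itself and tolerates any number of blanks. *)
Lemma tprog_of_run N p r s n r' s' : srun N p r s n r' s' ->
  all (all stack_sym) (stacks s) ->
  all (all stack_sym) (stacks s') /\
  forall c m j, exists c' m',
    trun (tprog_of p) ((r, c), tape_of m j (stacks s)) (n * (20 * N + 110))
         ((r', c'), tape_of m' j (stacks s')).
Proof.
elim=> {p r s n r' s'}.
- move=> i g r s n Hb Hz lt n0 Hs.
  have Hsz := size_flat_stacks s; split.
    by case: s Hs {lt Hsz} => [[[a b] c] k]; case: i => /=; rewrite Hb Hz.
  move=> c m j.
  have [pre [t [post [Ei Es Es' Hpre]]]] : exists pre t post,
    [/\ stk_index i = size pre, stacks s = pre ++ t :: post,
        stacks (set i s (g r :: get i s)) = pre ++ (g r :: t) :: post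
      & all (all stack_sym) pre].
    case: s Hs {lt Hsz} => [[[x y] z] w] /= /and4P[Hx Hy Hz' _].
    case: i => /=.
    + by exists [::], x, [:: y; z; w].
    + by exists [:: x], y, [:: z; w]; rewrite /= Hx.
    + by exists [:: x; y], z, [:: w]; rewrite /= Hx Hy.
    + by exists [:: x; y; z], w, [::]; rewrite /= Hx Hy Hz'.
  rewrite Es' Es in Hsz * => /=; rewrite Ei.
  by apply: push_run => //; rewrite Hsz; nia.
- move=> i r s n lt n0 Hs.
  have Hsz := size_flat_stacks s.
  have Hbe (t : seq sym) : all stack_sym t -> all stack_sym (behead t).
    by case: t => //= x t /andP[].
  have H4 : all (all stack_sym) (stacks (set i s (behead (get i s)))).
    by case: s Hs {lt Hsz} => [[[a b] c] k] /= /and5P[? ? ? ? _]; case: i;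
      rewrite /= ?Hbe //; do !(apply/andP; split => //).
  split=> // c m j.
  have [pre [t [post [[Ei Es Es' Et Hpre] Ht]]]] : exists pre t post,
    [/\ stk_index i = size pre, stacks s = pre ++ t :: post,
        stacks (set i s (behead (get i s))) = pre ++ behead t :: post,
        get i s = t & all (all stack_sym) pre] /\ all stack_sym t.
    case: s Hs {lt Hsz H4} => [[[x y] z] w] /= /and5P[Hx Hy Hz' Hw _].
    case: i => /=.
    + by exists [::], x, [:: y; z; w].
    + by exists [:: x], y, [:: z; w]; rewrite /= Hx.
    + by exists [:: x; y], z, [:: w]; rewrite /= Hx Hy.
    + by exists [:: x; y; z], w, [::]; rewrite /= Hx Hy Hz'.
  rewrite Es in Hsz; rewrite Es' Es Et /= Ei.
  by apply: pop_run => //; rewrite Hsz; nia.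
- move=> r s n n0 Hs; split=> // c m j; exists c, m.
  by apply: trun_act => //; nia.
- move=> p q r s r1 s1 r2 s2 n1 n2 n _ IH1 _ IH2 le Hs.
  have [Hs1 H1] := IH1 Hs; have [Hs2 H2] := IH2 Hs1; split=> // c m j.
  have [c1 [m1 {}H1]] := H1 c m j; have [c2 [m2 {}H2]] := H2 c1 m1 j.
  by exists c2, m2; apply: (RunSeq H1 H2); nia.
- move=> b p q r s r1 s1 n1 n _ IH le Hs.
  have [Hs1 H1] := IH Hs; split=> // c m j.
  have [c1 [m1 {}H1]] := H1 c m j.
  exists c1, m1; apply: (@RunIf _ _ _ _ _ (n1 * (20 * N + 110))); last by nia.
  by move: H1 => /=; case: (b r).
- move=> b p r s n Hb n0 Hs; split=> // c m j; exists c, m.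
  by apply: RunWhileF => //; nia.
- move=> b p r s r1 s1 r2 s2 n1 n2 n Hb _ IH1 _ IH2 le Hs.
  have [Hs1 H1] := IH1 Hs; have [Hs2 H2] := IH2 Hs1; split=> // c m j.
  have [c1 [m1 {}H1]] := H1 c m j; have [c2 [m2 {}H2]] := H2 c1 m1 j.
  by exists c2, m2; apply: (@RunWhileT _ _ _ _ _ _ _ _ _ H1 H2) => //; nia.
Qed.

(* The separator [SZero] is also an output symbol: on the stacks, the answer
   "no" is represented by [SOpen]. *)
Definition final_sym (s : sym) : sym := if s == SOpen then SZero else s.

(** The input word already stands on the tape as the first stack; its separator and those of three
    empty stacks are appended. *)
Definition init_prog : tprog :=
  let sep := TAct (fun v _ => (v, SZero, MoveR)) in
  TSeq (TSeq (TSeq (TSeq (TSeq (TSeq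
    (TWhile (fun _ s => s != Blank) (tmove MoveR)) sep) sep) sep) sep)
    (tmove MoveL)) rewind.

(** The separator of the first stack is replaced by a blank because [output] reads up to the first
    blank; what lies beyond it is then invisible. *)
Definition final_prog : tprog :=
  TSeq (TSeq (TWhile (fun _ s => s != SZero) (TAct (fun v s => (v, final_sym s, MoveR))))
    (TAct (fun v _ => (v, Blank, MoveL)))) rewind.

Lemma init_run w v : all nonblank w ->
  exists m, trun init_prog (v, init_tape w) (4 * size w + 20)
                 (v, tape_of m 1 [:: w; [::]; [::]; [::]]).
Proof.
move=> Hw; exists 1.
have -> : init_tape w = zip_tape [::] w by case: w {Hw}.
have H1 : forall l, trun (TWhile (fun _ s => s != Blank) (tmove MoveR))
   (v, zip_tape l w) (2 * size w + 1) (v, zip_tape (rev w ++ l) [::]).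
  elim: w Hw => [|x w IH] /=; first by move=> _ l; apply: RunWhileF.
  case/andP=> Hx Hw l.
  apply: (@RunWhileT _ _ _ (v, zip_tape (x :: l) w) _ 1 (2 * size w + 1)) => //.
  - by apply: trun_act => //; case: (w).
  - by rewrite rev_cons cat_rcons; apply: IH.
  - by lia.
have Hsep l : trun (TAct (fun v _ => (v, SZero, MoveR))) (v, zip_tape l [::]) 1
   (v, zip_tape (SZero :: l) [::]) by apply: trun_act.
have H2 := RunSeq (RunSeq (RunSeq (RunSeq (H1 [::]) (Hsep _) (leqnn _)) (Hsep _) (leqnn _))
  (Hsep _) (leqnn _)) (Hsep _) (leqnn _).
have H3 := @rewind_run v (nseq 4 SZero ++ rev w) 0 [:: Blank] _ _ (leqnn _).
have {}H3 := H3 ltac:(by rewrite all_cat /= all_rev).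
rewrite rev_cat revK in H3; rewrite /tape_of flat_cons -catA; rewrite -[(w ++ _) ++ _]catA in H3.
apply: (RunSeq (RunSeq H2 _ (leqnn _)) H3).
  by apply: (@trun_act _ _ _ 1) => //=; rewrite cats0.
by rewrite size_cat size_nseq size_rev; lia.
Qed.

Lemma final_run w v m j : all stack_sym w ->
  exists tp, trun final_prog (v, tape_of m j [:: w; [::]; [::]; [::]]) (4 * size w + 20) (v, tp) /\
    take_nonblank (tp.1.2 :: tp.2) = map final_sym w.
Proof.
move=> Hw; rewrite /tape_of flat_cons -catA cat_cons; set t := flat _ ++ _.
have H1 : forall l, trun
   (TWhile (fun _ s => s != SZero) (TAct (fun v s => (v, final_sym s, MoveR))))
   (v, zip_tape l (w ++ SZero :: t)) (2 * size w + 1)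
   (v, zip_tape (rev (map final_sym w) ++ l) (SZero :: t)).
  elim: w Hw => [|x w IH] /=; first by move=> _ l; apply: RunWhileF.
  case/andP=> /andP[Hx Hx'] Hw l.
  apply: (@RunWhileT _ _ _ (v, zip_tape (final_sym x :: l) (w ++ SZero :: t)) _ 1 (2 * size w + 1)) => //.
  - by apply: trun_act => //; case: (w).
  - by rewrite rev_cons cat_rcons; apply: IH.
  - by lia.
have Hf : all nonblank (map final_sym w).
  by apply/allP=> x /mapP[y /(allP Hw) /andP[Hy _] ->]; case: y Hy.
have H3 := @rewind_run v (rev (map final_sym w)) m (Blank :: t) _ _ (leqnn _).
have {}H3 := H3 ltac:(by rewrite all_rev).
eexists; split.
  apply: (RunSeq (RunSeq (H1 _) _ (leqnn _)) H3).
    by apply: (@trun_act _ _ _ 1) => //=; case: (_ ++ nseq m Blank).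
  by rewrite size_rev size_map; lia.
rewrite revK /=; case: (w) Hf => //= x w' /andP[Hx Hf].
by elim: w' x Hx Hf => [|y w' IH] x Hx /=; [case: (final_sym x) Hx |
  case/andP=> Hy Hf; rewrite -(IH y) //; case: (final_sym x) Hx].
Qed.

Lemma sprog_TM (p : sprog) : exists M : TM, forall w out N n r,
  all stack_sym w ->
  srun N p Blank (w, [::], [::], [::]) n r (out, [::], [::], [::]) ->
  exists cf : config M,
    exec (n * (20 * N + 110) + 4 * size w + 4 * size out + 40) (init M w) = Some cf /\
    output cf = map final_sym out.
Proof.
exists (TM_of (TSeq (TSeq init_prog (tprog_of p)) final_prog)) => w out N n r Hw H.
have Hw' : all nonblank w by apply: sub_all Hw => x /andP[].
have [m1 H1] := @init_run w (Blank, Blank) Hw'.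
have Hs : all (all stack_sym) (stacks (w, [::], [::], [::])) by rewrite /= Hw.
have [Hout H2] := tprog_of_run H Hs.
have [c [m2 {}H2]] := H2 Blank m1 1.
have [|tp [H3 E]] := @final_run out (r, c) m2 1; first by case/andP: Hout.
have H4 := RunSeq (RunSeq H1 H2 (leqnn _)) H3 (leqnn _).
exists (TM_config (None, (r, c, tp))); split.
  apply: TM_of_exec; apply: (trun_le H4); lia.
by rewrite -E; case: (tp) => [[]].
Qed.

(** * Binary trees on a stack *)

Inductive atom := ALeaf | AOpen | AClose | ASep.

Inductive tree := At of atom | Cn of tree & tree.

Definition atom_sym (a : atom) : sym :=
  match a with ALeaf => SLeaf | AOpen => SOpen | AClose => SClose | ASep => SSep end.

(** Polish notation is self-delimiting, so trees can lie on one stack without separators. The four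
    atoms and [SOne] for a pair are exactly the symbols other than [Blank] and [SZero], which the
    tape layout reserves. *)
Fixpoint polish (t : tree) : seq sym :=
  match t with
  | At a => [:: atom_sym a]
  | Cn x y => SOne :: polish x ++ polish y
  end.

Definition sz (t : tree) : nat := size (polish t).
Definition head_sym (t : tree) : sym := if t is At a then atom_sym a else SOne.
Definition hd (t : tree) : tree := if t is Cn x _ then x else t.
Definition tl (t : tree) : tree := if t is Cn _ y then y else t.

Lemma sz_Cn x y : sz (Cn x y) = (sz x + sz y).+1.
Proof. by rewrite /sz /= size_cat. Qed.

Lemma sz_gt0 t : 0 < sz t.
Proof. by case: t. Qed.

Lemma atom_sym_nonblank a : atom_sym a != Blank.
Proof. by case: a. Qed.

Lemma atom_sym_nonsep a : atom_sym a != SZero.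
Proof. by case: a. Qed.

Lemma polish_stack_sym t : all stack_sym (polish t).
Proof. by elim: t => [[]|x IHx y IHy] //=; rewrite all_cat IHx. Qed.

Lemma srun_le N p r s n r' s' m : srun N p r s n r' s' -> n <= m -> srun N p r s m r' s'.
Proof.
move=> H; case: H m => {p r s n r' s'}.
- by move=> i g r s n ? ? ? ? m ?; apply: RunPush => //; lia.
- by move=> i r s n ? ? m ?; apply: RunPop => //; lia.
- by move=> r s n ? m ?; apply: RunNop; lia.
- by move=> p q r s r1 s1 r2 s2 n1 n2 n H1 H2 ? m ?; apply: RunSSeq H1 H2 _; lia.
- by move=> b p q r s r1 s1 n1 n H1 ? m ?; apply: RunSIf H1 _; lia.
- by move=> b p r s n ? ? m ?; apply: RunSWhileF => //; lia.
- by move=> b p r s r1 s1 r2 s2 n1 n2 n ? H1 H2 ? m ?; apply: (RunSWhileT _ H1 H2) => //; lia.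
Qed.

Definition nonblankb (s : sym) : bool := s != Blank.

Definition push_sym i s := SPush i (fun=> s).

Definition move_body (dst : stk) : sprog :=
  SSeq (SSeq (SSeq (SPop StkA) (SPush dst id))
    (SIf (eq_op^~ SOne) (SSeq (SPush StkK id) (SPush StkK id)) SNop)) (SPop StkK).

(* Moves the tree on top of stack A, reversed, to [dst]; the height of stack K
   is the number of trees still to be moved after the current one. *)
Definition move_tree (dst : stk) : sprog :=
  SSeq (SSeq (push_sym StkK SOne) (SPop StkK)) (SWhile nonblankb (move_body dst)).

Definition other (toC : bool) := if toC then StkC else StkB.
Definition mkst (toC : bool) a x y k : store := if toC then (a, y, x, k) else (a, x, y, k).

(** Stated as prefixing the transfer of [d] to an arbitrary later run of the loop, so that the two
    subtrees of a pair can be handled one after the other. A pair pushes two marks on stack K and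
    every symbol pops one, which leaves one pending mark for the second subtree. *)
Lemma move_loop N (toC : bool) d r a x y k n r' s' :
  r != Blank ->
  size a + size x + size y + size k + 2 * sz d + 2 <= N ->
  srun N (SWhile nonblankb (move_body (other toC))) (head Blank k)
    (mkst toC a (rev (polish d) ++ x) y (behead k)) n r' s' ->
  srun N (SWhile nonblankb (move_body (other toC))) r (mkst toC (polish d ++ a) x y k)
    (n + 12 * sz d) r' s'.
Proof.
elim: d r a x y k n => [c|u IHu v IHv] r a x y k n Hr le H.
  have Hc : atom_sym c == SOne = false by case: c {le H}.
  have Hb := atom_sym_nonblank c; have Hz := atom_sym_nonsep c.
  apply: (@RunSWhileT _ _ _ _ _ _ _ _ _ 8 n) => //; last first.
  - by rewrite /sz /=; lia.
  - exact: H.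
  apply: (@RunSSeq _ _ _ _ _ (atom_sym c) (mkst toC a (atom_sym c :: x) y k) _ _ 6 1) => //; last first.
    by case: toC {H} => /=; apply: RunPop => //=; rewrite /sz /= in le; lia.
  apply: (@RunSSeq _ _ _ _ _ (atom_sym c) (mkst toC a (atom_sym c :: x) y k) _ _ 2 2) => //; last first.
    by apply: (@RunSIf _ _ _ _ _ _ _ _ 1) => //; rewrite Hc; apply: RunNop.
  apply: (@RunSSeq _ _ _ _ _ (atom_sym c) (mkst toC a x y k) _ _ 1 1) => //.
    by case: toC {H}; apply: RunPop => //=; rewrite /sz /= in le; lia.
  by case: toC {H}; apply: RunPush => //=; rewrite /sz /= in le; lia.
rewrite sz_Cn in le.
apply: (@RunSWhileT _ _ _ _ _ SOne (mkst toC (polish u ++ polish v ++ a) (SOne :: x) y (SOne :: k)) _ _ 9 (n + 12 * sz v + 12 * sz u)) => //; last first.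
- by rewrite sz_Cn; lia.
- apply: IHu => //.
    by rewrite size_cat -/(sz v) /=; have := sz_gt0 v; lia.
  apply: IHv => //=.
    by rewrite !size_cat size_rev /= -/(sz u); lia.
  by move: H; rewrite /= rev_cons cat_rcons rev_cat -catA.
have Hsz : size (polish u ++ polish v ++ a) = sz u + sz v + size a.
  by rewrite !size_cat addnA.
rewrite [polish (Cn u v) ++ a]/= -catA.
apply: (@RunSSeq _ _ _ _ _ SOne (mkst toC (polish u ++ polish v ++ a) (SOne :: x) y (SOne :: SOne :: k)) _ _ 6 1) => //; last first.
  by case: (toC) => /=; apply: RunPop => //=; rewrite Hsz; lia.
apply: (@RunSSeq _ _ _ _ _ SOne (mkst toC (polish u ++ polish v ++ a) (SOne :: x) y k) _ _ 2 3) => //; last first.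
  apply: (@RunSIf _ _ _ _ _ _ _ _ 2) => //.
  apply: (@RunSSeq _ _ _ _ _ SOne (mkst toC (polish u ++ polish v ++ a) (SOne :: x) y (SOne :: k)) _ _ 1 1) => //.
    by case: (toC) => /=; apply: RunPush => //=; rewrite Hsz; lia.
  by case: (toC) => /=; apply: RunPush => //=; rewrite Hsz; lia.
apply: (@RunSSeq _ _ _ _ _ SOne (mkst toC (polish u ++ polish v ++ a) x y k) _ _ 1 1) => //.
  by case: (toC); apply: RunPop => //=; rewrite Hsz; lia.
by case: (toC); apply: RunPush => //=; rewrite Hsz; lia.
Qed.

Lemma move_tree_run N (toC : bool) d r a x y n :
  size a + size x + size y + 2 * sz d + 2 <= N -> 12 * sz d + 10 <= n ->
  srun N (move_tree (other toC)) r (mkst toC (polish d ++ a) x y [::]) n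
    Blank (mkst toC a (rev (polish d) ++ x) y [::]).
Proof.
move=> le len; have Hsz : size (polish d ++ a) = sz d + size a by rewrite size_cat.
have gt0 := sz_gt0 d.
(* Pushing and popping on stack K loads a nonblank symbol into the register, so that the loop is
   entered with stack K empty. *)
apply: (@RunSSeq _ _ _ _ _ SOne (mkst toC (polish d ++ a) x y [::]) _ _ 2 (1 + 12 * sz d));
  last by lia.
  apply: (@RunSSeq _ _ _ _ _ r (mkst toC (polish d ++ a) x y [:: SOne]) _ _ 1 1) => //.
    by case: toC; apply: RunPush => //=; lia.
  by case: toC; apply: RunPop => //=; lia.
by apply: move_loop => //=; [lia | exact: RunSWhileF].
Qed.

Definition flush (src : stk) (p : sprog) : sprog :=
  SSeq (SPop src) (SWhile nonblankb (SSeq p (SPop src))).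

(* [f w m]: the store when [w] is left on [src] and [m] has been moved. *)
Lemma flush_run N src p (f : seq sym -> seq sym -> store) w m c n r :
  (forall w m, get src (f w m) = w) ->
  (forall x w m, set src (f (x :: w) m) w = f w m) ->
  (forall w', size w' <= size w -> forall m', size w' + size m' <= size w + size m ->
     weight (f w' m') <= N) ->
  (forall x w' m', size w' + size m' < size w + size m -> x != Blank -> x != SZero ->
     srun N p x (f w' m') c x (f w' (x :: m'))) ->
  all stack_sym w -> (c + 3) * size w + 3 <= n ->
  srun N (flush src p) r (f w m) n Blank (f [::] (rev w ++ m)).
Proof.
move=> Hget Hset Htot Hpush Hw le.
have Hpop w' m' r' : size w' <= size w -> size w' + size m' <= size w + size m ->
    srun N (SPop src) r' (f w' m') 1 (head Blank w') (f (behead w') m').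
  move=> le1 le2; have {2}-> : w' = get src (f w' m') by rewrite Hget.
  have -> : f (behead w') m' = set src (f w' m') (behead (get src (f w' m'))).
    rewrite Hget; case: w' {le1 le2} => [|x w'] /=; last by rewrite Hset.
    have -> : f [::] m' = set src (f [:: Blank] m') [::] by rewrite Hset.
    by case: src (f _ _) {Hget Hset Hpush} => -[[[? ?] ?] ?].
  by apply: RunPop => //; apply: Htot.
apply: (@RunSSeq _ _ _ _ _ (head Blank w) (f (behead w) m) _ _ 1 ((c + 3) * size w + 1));
  [exact: Hpop | | by lia].
have : forall w', size w' <= size w -> forall m', all stack_sym w' -> size w' + size m' <= size w + size m ->
  srun N (SWhile nonblankb (SSeq p (SPop src))) (head Blank w') (f (behead w') m')
    ((c + 3) * size w' + 1) Blank (f [::] (rev w' ++ m')).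
  elim=> [|x w' IH] lew m' /=; first by move=> *; apply: RunSWhileF => //; lia.
  case/andP=> /andP[Hx Hx'] Hw' le'.
  apply: (@RunSWhileT _ _ _ _ _ (head Blank w') (f (behead w') (x :: m')) _ _ (c + 1) ((c + 3) * size w' + 1)) => //.
  - apply: (@RunSSeq _ _ _ _ _ _ _ _ _ c 1); last exact: leqnn.
    + by apply: Hpush => //; move: lew => /=; lia.
    + by apply: Hpop => /=; move: lew => /=; lia.
  - by rewrite rev_cons cat_rcons; apply: IH => //=; move: lew => /=; lia.
  - by lia.
by apply.
Qed.

Definition sA (a : seq sym) : store := (a, [::], [::], [::]).

Definition drop_prog := SSeq (move_tree StkB) (flush StkB SNop).
(** Moving and flushing each reverse a word. The second copy reaches stack C in its proper order and
    must be reversed twice more on the way to stack A, hence the detour through stack B. *)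
Definition dup_prog :=
  SSeq (SSeq (SSeq (move_tree StkB)
    (flush StkB (SSeq (SPush StkA id) (SPush StkC id))))
    (flush StkC (SPush StkB id))) (flush StkB (SPush StkA id)).
Definition swap_prog :=
  SSeq (SSeq (SSeq (move_tree StkB) (move_tree StkC))
    (flush StkB (SPush StkA id))) (flush StkC (SPush StkA id)).

Lemma drop_run N d r a n : size a + 2 * sz d + 2 <= N -> 20 * sz d + 20 <= n ->
  srun N drop_prog r (sA (polish d ++ a)) n Blank (sA a).
Proof.
move=> le len.
have H1 := @move_tree_run N false d r a [::] [::] _ ltac:(by rewrite /=; lia) (leqnn _).
rewrite /= cats0 in H1; apply: (RunSSeq H1).
  apply: (@flush_run _ _ _ (fun w m => (a, w, [::], [::])) _ [::] 1 (4 * sz d + 3)) => //.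
  - by move=> w' le1 m' le2 /=; rewrite size_rev -/(sz d) in le1; lia.
  - by move=> *; apply: RunNop.
  - by rewrite all_rev polish_stack_sym.
  - by rewrite size_rev -/(sz d); lia.
by lia.
Qed.

Lemma dup_run N d r a n : size a + 3 * sz d + 2 <= N -> 40 * sz d + 40 <= n ->
  srun N dup_prog r (sA (polish d ++ a)) n Blank (sA (polish d ++ polish d ++ a)).
Proof.
move=> le len.
have H1 := @move_tree_run N false d r a [::] [::] _ ltac:(by rewrite /=; lia) (leqnn _).
rewrite /= cats0 in H1.
apply: (@RunSSeq _ _ _ _ _ Blank (polish d ++ a, rev (polish d), [::], [::]) _ _ (25 * sz d + 20) (5 * sz d + 5)); last by lia.
  apply: (@RunSSeq _ _ _ _ _ Blank (polish d ++ a, [::], polish d, [::]) _ _ (20 * sz d + 15) (5 * sz d + 5)); last by lia.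
    apply: (RunSSeq H1 (n2 := 6 * sz d + 3)); last by lia.
    have := @flush_run N StkB (SSeq (SPush StkA id) (SPush StkC id))
      (fun w m => (m ++ a, w, m, [::])) (rev (polish d)) [::] 2 (6 * sz d + 3) Blank.
    rewrite revK cats0; apply=> //.
    + by move=> w' le1 m' le2 /=; rewrite size_rev -/(sz d) /= in le1 le2; rewrite size_cat; lia.
    + move=> x w' m' le2 Hx Hx'; rewrite size_rev -/(sz d) /= in le2.
      apply: (@RunSSeq _ _ _ _ _ x (x :: m' ++ a, w', m', [::]) _ _ 1 1) => //;
      by apply: RunPush => //=; rewrite size_cat; lia.
    + by rewrite all_rev polish_stack_sym.
    + by rewrite size_rev -/(sz d); lia.
  have := @flush_run N StkC (SPush StkB id)
    (fun w m => (polish d ++ a, m, w, [::])) (polish d) [::] 1 (5 * sz d + 5) Blank.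
  rewrite cats0; apply=> //.
  - by move=> w' le1 m' le2 /=; rewrite -/(sz d) /= in le1 le2; rewrite size_cat -/(sz d); lia.
  - move=> x w' m' le2 Hx Hx'; rewrite -/(sz d) /= in le2.
    by apply: RunPush => //=; rewrite size_cat -/(sz d); lia.
  - exact: polish_stack_sym.
  - by rewrite -/(sz d); lia.
have := @flush_run N StkB (SPush StkA id)
  (fun w m => (m ++ polish d ++ a, w, [::], [::])) (rev (polish d)) [::] 1 (5 * sz d + 5) Blank.
rewrite revK cats0; apply=> //.
- by move=> w' le1 m' le2 /=; rewrite size_rev -/(sz d) /= in le1 le2; rewrite !size_cat -/(sz d); lia.
- move=> x w' m' le2 Hx Hx'; rewrite size_rev -/(sz d) /= in le2.
  by apply: RunPush => //=; rewrite !size_cat -/(sz d); lia.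
- by rewrite all_rev polish_stack_sym.
- by rewrite size_rev -/(sz d); lia.
Qed.

Lemma swap_run N d e r a n :
  size a + 2 * sz d + 2 * sz e + 2 <= N -> 20 * sz d + 20 * sz e + 40 <= n ->
  srun N swap_prog r (sA (polish d ++ polish e ++ a)) n Blank (sA (polish e ++ polish d ++ a)).
Proof.
move=> le len.
have H1 := @move_tree_run N false d r (polish e ++ a) [::] [::] _
  ltac:(by rewrite size_cat -/(sz e) /=; lia) (leqnn _).
have H2 := @move_tree_run N true e Blank a [::] (rev (polish d)) _
  ltac:(by rewrite size_rev -/(sz d) /=; lia) (leqnn _).
rewrite /= cats0 in H1; rewrite /= cats0 in H2.
apply: (@RunSSeq _ _ _ _ _ Blank (polish d ++ a, [::], rev (polish e), [::]) _ _ (12 * sz d + 12 * sz e + 20 + (4 * sz d + 3)) (5 * sz e + 5)); last by lia.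
  apply: (RunSSeq (RunSSeq H1 H2 (leqnn _)) (n2 := 4 * sz d + 3)); last by lia.
  have := @flush_run N StkB (SPush StkA id)
    (fun w m => (m ++ a, w, rev (polish e), [::])) (rev (polish d)) [::] 1 (4 * sz d + 3) Blank.
  rewrite revK cats0; apply=> //.
  - by move=> w' le1 m' le2 /=; rewrite size_rev -/(sz d) /= in le1 le2;
      rewrite !size_cat size_rev -/(sz e); lia.
  - move=> x w' m' le2 Hx Hx'; rewrite size_rev -/(sz d) /= in le2.
    by apply: RunPush => //=; rewrite !size_cat size_rev -/(sz e); lia.
  - by rewrite all_rev polish_stack_sym.
  - by rewrite size_rev -/(sz d); lia.
have := @flush_run N StkC (SPush StkA id)
  (fun w m => (m ++ polish d ++ a, [::], w, [::])) (rev (polish e)) [::] 1 (5 * sz e + 5) Blank.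
rewrite revK cats0; apply=> //.
- by move=> w' le1 m' le2 /=; rewrite size_rev -/(sz e) /= in le1 le2; rewrite !size_cat -/(sz d); lia.
- move=> x w' m' le2 Hx Hx'; rewrite size_rev -/(sz e) /= in le2.
  by apply: RunPush => //=; rewrite !size_cat -/(sz d); lia.
- by rewrite all_rev polish_stack_sym.
- by rewrite size_rev -/(sz e); lia.
Qed.

(** Monotonicity is included because bounds are applied to sizes that are themselves known only up
    to an upper bound; [n.+1] keeps the base positive at 0. *)
Definition pol (q : nat -> nat) : Prop :=
  {homo q : m n / m <= n} /\ exists c k, forall n, q n <= c * n.+1 ^ k.

Lemma pol_const c : pol (fun=> c).
Proof. by split=> //; exists c, 0 => n; rewrite muln1. Qed.

Lemma pol_id : pol id.
Proof. by split=> //; exists 1, 1 => n; rewrite mul1n expn1. Qed.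

Lemma pol_add f g : pol f -> pol g -> pol (fun n => f n + g n).
Proof.
move=> [mf [c1 [k1 H1]]] [mg [c2 [k2 H2]]]; split.
  by move=> m n le; rewrite leq_add ?mf ?mg.
exists (c1 + c2), (k1 + k2) => n; rewrite mulnDl leq_add //.
  by apply: leq_trans (H1 n) _; rewrite leq_mul // leq_pexp2l //; lia.
by apply: leq_trans (H2 n) _; rewrite leq_mul // leq_pexp2l //; lia.
Qed.

Lemma pol_mul f g : pol f -> pol g -> pol (fun n => f n * g n).
Proof.
move=> [mf [c1 [k1 H1]]] [mg [c2 [k2 H2]]]; split.
  by move=> m n le; rewrite leq_mul ?mf ?mg.
exists (c1 * c2), (k1 + k2) => n.
by rewrite expnD mulnACA leq_mul.
Qed.

Lemma pol_comp f g : pol f -> pol g -> pol (fun n => f (g n)).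
Proof.
move=> [mf [c1 [k1 H1]]] [mg [c2 [k2 H2]]]; split.
  by move=> m n le; rewrite mf ?mg.
(* The successor of [g n] is absorbed by enlarging the constant: [(g n).+1 <= c2.+1 * n.+1 ^ k2]. *)
exists (c1 * c2.+1 ^ k1), (k2 * k1) => n.
apply: leq_trans (H1 _) _; rewrite -mulnA leq_mul // expnM -expnMn.
case: k1 {H1} => // k1; rewrite leq_exp2r //.
have := H2 n; have : 0 < n.+1 ^ k2 by rewrite expn_gt0.
by nia.
Qed.

Lemma pol_exp f k : pol f -> pol (fun n => f n ^ k).
Proof.
move=> Hf; elim: k => [|k IH]; first exact: pol_const.
have [mo [c [j H]]] := pol_mul Hf IH; split.
  by move=> m n le; rewrite !expnS mo.
by exists c, j => n; rewrite expnS H.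
Qed.

Ltac pol_tac := repeat first
  [ assumption | exact: pol_const | exact: pol_id
  | apply: pol_add | apply: pol_mul | apply: pol_exp
  | match goal with H : pol ?q |- pol (fun n => ?q _) => apply: (pol_comp H) end ].

(* The program [p] turns the tree [d] on top of stack A into [d'], within [c] steps
   and using at most [c] symbols for the part of the stacks above the given rest. *)
Definition runs (p : sprog) (d d' : tree) (c : nat) : Prop :=
  sz d' <= c /\ forall a N r, c + size a <= N ->
    exists r', srun N p r (sA (polish d ++ a)) c r' (sA (polish d' ++ a)).

Lemma runs_le p d d' c c' : runs p d d' c -> c <= c' -> runs p d d' c'.
Proof.
move=> [H1 H2] le; split; first by lia.
move=> a N r leN; have [|r' H] := H2 a N r; first by lia.
by exists r'; apply: srun_le H le.
Qed.

Lemma runs_seq p q d d1 d2 c1 c2 : runs p d d1 c1 -> runs q d1 d2 c2 ->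
  runs (SSeq p q) d d2 (c1 + c2).
Proof.
move=> [H1 E1] [H2 E2]; split; first by lia.
move=> a N r leN; have [|r1 {}E1] := E1 a N r; first by lia.
have [|r2 {}E2] := E2 a N r1; first by lia.
by exists r2; apply: RunSSeq E1 E2 _.
Qed.

Lemma runs_nop d : runs SNop d d (sz d).
Proof. by split=> // a N r _; exists r; apply: RunNop; apply: sz_gt0. Qed.

Lemma runs_atom a d : runs (SSeq drop_prog (push_sym StkA (atom_sym a))) d (At a) (30 * sz d + 30).
Proof.
split=> [|b N r leN]; first by rewrite /sz /=; lia.
exists Blank; apply: (@RunSSeq _ _ _ _ _ Blank (sA b) _ _ (20 * sz d + 20) 1); last by lia.
  by apply: drop_run; lia.
by apply: RunPush => //=; rewrite ?atom_sym_nonblank ?atom_sym_nonsep //; lia.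
Qed.

(** Popping the mark [SOne] of a pair leaves its two components as separate trees on the stack; an
    atom is simply pushed back. *)
Definition hd_prog :=
  SSeq (SPop StkA) (SIf (eq_op^~ SOne) (SSeq swap_prog drop_prog) (SPush StkA id)).
Definition tl_prog :=
  SSeq (SPop StkA) (SIf (eq_op^~ SOne) drop_prog (SPush StkA id)).

Lemma runs_hd d : runs hd_prog d (hd d) (60 * sz d + 100).
Proof.
split=> [|a N r leN]; first by case: d => //= x y; rewrite sz_Cn; lia.
case: d leN => [c|x y] /= leN.
  rewrite /sz /= in leN *.
  exists (atom_sym c); apply: (@RunSSeq _ _ _ _ _ (atom_sym c) (sA a) _ _ 1 2); last by lia.
    by apply: RunPop => //=; lia.
  apply: (@RunSIf _ _ _ _ _ _ _ _ 1) => //; case: c => /=;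
    by apply: RunPush => //=; lia.
rewrite sz_Cn in leN *; exists Blank; rewrite -catA.
apply: (@RunSSeq _ _ _ _ _ SOne (sA (polish x ++ polish y ++ a)) _ _ 1 (50 * (sz x + sz y) + 90)); last by lia.
  by apply: RunPop => //=; rewrite !size_cat -/(sz x) -/(sz y); lia.
apply: (@RunSIf _ _ _ _ _ _ _ _ (50 * (sz x + sz y) + 89)) => /=; last by lia.
apply: (@RunSSeq _ _ _ _ _ Blank (sA (polish y ++ polish x ++ a)) _ _ (20 * sz x + 20 * sz y + 40) (20 * sz y + 20)); last by lia.
  by apply: swap_run; lia.
by apply: drop_run; rewrite ?size_cat -?/(sz x) -?/(sz y); lia.
Qed.

Lemma runs_tl d : runs tl_prog d (tl d) (60 * sz d + 100).
Proof.
split=> [|a N r leN]; first by case: d => //= x y; rewrite sz_Cn; lia.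
case: d leN => [c|x y] /= leN.
  rewrite /sz /= in leN *.
  exists (atom_sym c); apply: (@RunSSeq _ _ _ _ _ (atom_sym c) (sA a) _ _ 1 2); last by lia.
    by apply: RunPop => //=; lia.
  apply: (@RunSIf _ _ _ _ _ _ _ _ 1) => //; case: c => /=;
    by apply: RunPush => //=; lia.
rewrite sz_Cn in leN *; exists Blank; rewrite -catA.
apply: (@RunSSeq _ _ _ _ _ SOne (sA (polish x ++ polish y ++ a)) _ _ 1 (50 * (sz x + sz y) + 90)); last by lia.
  by apply: RunPop => //=; rewrite !size_cat -/(sz x) -/(sz y); lia.
apply: (@RunSIf _ _ _ _ _ _ _ _ (50 * (sz x + sz y) + 89)) => /=; last by lia.
by apply: drop_run; rewrite ?size_cat -?/(sz x) -?/(sz y); lia.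
Qed.

Definition pair_prog p q :=
  SSeq (SSeq (SSeq dup_prog q) (SSeq swap_prog p)) (push_sym StkA SOne).

Lemma runs_pair p q d d1 d2 c1 c2 : runs p d d1 c1 -> runs q d d2 c2 ->
  runs (pair_prog p q) d (Cn d1 d2) (100 * sz d + c1 + 30 * c2 + 100).
Proof.
move=> [H1 E1] [H2 E2]; split; first by rewrite sz_Cn; lia.
have gt0 := sz_gt0 d.
move=> a N r leN.
have [|r2 {}E2] := E2 (polish d ++ a) N Blank; first by rewrite size_cat -/(sz d); lia.
have [|r1 {}E1] := E1 (polish d2 ++ a) N Blank; first by rewrite size_cat -/(sz d2); lia.
exists r1.
apply: (@RunSSeq _ _ _ _ _ r1 (sA (polish d1 ++ polish d2 ++ a)) _ _
  (100 * sz d + c1 + 30 * c2 + 90) 1); [ | | by lia]; last first.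
  rewrite /= -catA; apply: RunPush => //=.
  by rewrite !size_cat -/(sz d1) -/(sz d2); lia.
apply: (@RunSSeq _ _ _ _ _ r2 (sA (polish d2 ++ polish d ++ a)) _ _
  (40 * sz d + c2 + 40) (20 * sz d2 + 20 * sz d + 40 + c1)); last by lia.
  apply: (RunSSeq _ E2 (n1 := 40 * sz d + 40)); last by lia.
  by apply: dup_run; lia.
apply: (RunSSeq _ E1 (leqnn _)).
by apply: swap_run; lia.
Qed.

Lemma polish_head t : polish t = head_sym t :: behead (polish t).
Proof. by case: t. Qed.

Lemma head_sym_nonblank t : head_sym t != Blank.
Proof. by case: t => [[]|]. Qed.

Lemma head_sym_nonsep t : head_sym t != SZero.
Proof. by case: t => [[]|]. Qed.

(* [peek] reads the root of a tree computed from a copy of the current one;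
   [unpeek] removes that tree again. *)
Definition peek p := SSeq (SSeq dup_prog p) (SPop StkA).
Definition unpeek := SSeq (SPush StkA id) drop_prog.

Lemma peek_run p d e c a N r : runs p d e c -> c + 3 * sz d + 2 + size a <= N ->
  srun N (peek p) r (sA (polish d ++ a)) (c + 40 * sz d + 41)
    (head_sym e) (sA (behead (polish e) ++ polish d ++ a)).
Proof.
move=> [H1 E1] leN.
have [|r1 {}E1] := E1 (polish d ++ a) N Blank; first by rewrite size_cat -/(sz d); lia.
apply: (@RunSSeq _ _ _ _ _ r1 (sA (polish e ++ polish d ++ a)) _ _ (40 * sz d + 40 + c) 1); last by lia.
  by apply: (RunSSeq _ E1 (leqnn _)); apply: dup_run; lia.
rewrite {1}polish_head; apply: RunPop => //=.
by rewrite !size_cat size_behead -/(sz e) -/(sz d); have := sz_gt0 e; lia.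
Qed.

Lemma unpeek_run e d a N : 2 * sz e + 2 + sz d + size a <= N ->
  srun N unpeek (head_sym e) (sA (behead (polish e) ++ polish d ++ a)) (20 * sz e + 21)
    Blank (sA (polish d ++ a)).
Proof.
move=> leN.
apply: (@RunSSeq _ _ _ _ _ (head_sym e) (sA (polish e ++ polish d ++ a)) _ _ 1 (20 * sz e + 20)); last by lia.
  rewrite [in X in srun _ _ _ _ _ _ X]polish_head.
  apply: RunPush; rewrite //= ?head_sym_nonblank ?head_sym_nonsep //.
  by rewrite !size_cat size_behead -/(sz e) -/(sz d); have := sz_gt0 e; lia.
by apply: drop_run; rewrite ?size_cat -?/(sz d); lia.
Qed.

Definition if_prog (t : sym -> bool) p q1 q2 :=
  SSeq (peek p) (SIf t (SSeq unpeek q1) (SSeq unpeek q2)).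

Lemma runs_if t p q1 q2 d e d' c c' : runs p d e c ->
  runs (if t (head_sym e) then q1 else q2) d d' c' ->
  runs (if_prog t p q1 q2) d d' (50 * sz d + 30 * c + c' + 100).
Proof.
move=> Hp [H2 E2]; have [H1 _] := Hp; split; first by lia.
move=> a N r leN.
have [|r2 {}E2] := E2 a N Blank; first by lia.
exists r2; apply: (RunSSeq (peek_run r Hp _) (n2 := 20 * sz e + 22 + c')); [by lia | | by lia].
apply: (@RunSIf _ _ _ _ _ _ _ _ (20 * sz e + 21 + c')); last by lia.
have Hu : srun N unpeek (head_sym e) (sA (behead (polish e) ++ polish d ++ a)) (20 * sz e + 21)
    Blank (sA (polish d ++ a)) by apply: unpeek_run; lia.
by case: (t (head_sym e)) E2 => E2; apply: (RunSSeq Hu E2).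
Qed.

Fixpoint foldT (F : tree -> tree) (e acc l : tree) : tree :=
  if l is Cn x l' then foldT F e (F (Cn (Cn e acc) x)) l' else acc.

(** All the accumulators of this particular fold are bounded; a bound on the final value would not
    control the running time. *)
Fixpoint acc_le (F : tree -> tree) (e : tree) (M : nat) (acc l : tree) : Prop :=
  sz acc <= M /\ (if l is Cn x l' then acc_le F e M (F (Cn (Cn e acc) x)) l' else True).

Definition fold_step (F : tree -> tree) (s : tree) : tree :=
  Cn (Cn (hd (hd s)) (F (Cn (hd s) (hd (tl s))))) (tl (tl s)).

Definition fold_prog step :=
  SSeq (SSeq (peek tl_prog)
    (SSeq (SWhile (eq_op^~ SOne) (SSeq (SSeq unpeek step) (peek tl_prog))) unpeek))
    (SSeq hd_prog tl_prog).

(** The loop state [Cn (Cn e acc) l] is a single tree, and the register always holds the root symbol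
    of the remaining list, obtained by [peek tl_prog]. There are at most [sz l] rounds, and the
    state never exceeds [m], where the summand 2 counts its two outer pairs. *)
Lemma runs_fold F step q e M acc l :
  {homo q : m n / m <= n} ->
  (forall s, runs step s (fold_step F s) (q (sz s))) ->
  acc_le F e M acc l ->
  let m := sz e + M + sz l + 2 in
  runs (fold_prog step) (Cn (Cn e acc) l) (foldT F e acc l) (sz l * (q m + 500 * m + 500) + 1000 * m + 1000).
Proof.
move=> mq Hstep Hacc /=.
set m := sz e + M + sz l + 2; set K := q m + 500 * m + 500.
have Hle : forall acc l, acc_le F e M acc l -> sz (foldT F e acc l) <= M.
  by move=> acc' l'; elim: l' acc' => [?|x _ l' IH] acc' /= [? //]; apply: IH.
split; first by have := Hle _ _ Hacc; lia.
move=> a N r leN.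
pose s := Cn (Cn e acc) l.
have Hs acc' l' : sz acc' <= M -> sz l' <= sz l -> sz (Cn (Cn e acc') l') <= m.
  by rewrite !sz_Cn /m; lia.
have acc_leM acc' l' : acc_le F e M acc' l' -> sz acc' <= M by case: l' => [?|? ?] [].
have HNm : q m + 400 * m + 400 + size a <= N by have := sz_gt0 l; nia.
have Hloop : forall l' acc', acc_le F e M acc' l' -> sz l' <= sz l ->
    exists c', srun N (SWhile (eq_op^~ SOne) (SSeq (SSeq unpeek step) (peek tl_prog)))
      (head_sym l') (sA (behead (polish l') ++ polish (Cn (Cn e acc') l') ++ a)) (sz l' * K)
      (atom_sym c') (sA (behead (polish (At c')) ++ polish (Cn (Cn e (foldT F e acc' l')) (At c')) ++ a)).
  elim=> [c|x _ l' IH] acc' Ha lel.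
    by exists c; apply: RunSWhileF; [case: (c) | rewrite /sz /= /K; lia].
  have sM := acc_leM _ _ Ha.
  have [_ Ha'] := Ha; have [|c' H] := IH _ Ha'; first by rewrite sz_Cn in lel; lia.
  exists c'.
  set s1 := Cn (Cn e acc') (Cn x l').
  have sm1 : sz s1 <= m by apply: Hs.
  set s2 := Cn (Cn e (F (Cn (Cn e acc') x))) l'.
  have sm2 : sz s2 <= m by apply: Hs; [exact: acc_leM Ha' | rewrite sz_Cn in lel; lia].
  have [H2 E2] := Hstep s1; rewrite /= -/s2 in E2.
  have qm := mq _ _ sm1.
  have [|r2 {}E2] := E2 a N Blank; first by lia.
  apply: (RunSWhileT _ _ H (n1 := 20 * m + 21 + q m + (60 * m + 100 + 40 * m + 41))) => //; last first.
    rewrite sz_Cn /K; nia.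
  apply: (RunSSeq (RunSSeq _ E2 (n1 := 20 * m + 21) (leqnn _)) _ (n2 := 60 * m + 100 + 40 * m + 41)); last by lia.
    apply: srun_le (unpeek_run (e := Cn x l') _) _; last by lia.
    by lia.
  apply: srun_le (peek_run _ (runs_tl s2) _) _; by lia.
have [c' H] := Hloop l acc Hacc (leqnn _).
have sM := acc_leM _ _ Hacc.
have ss : sz s <= m by apply: Hs.
set s3 := Cn (Cn e (foldT F e acc l)) (At c') in H.
have ss3 : sz s3 <= m by apply: Hs; [exact: Hle | exact: sz_gt0].
have [_ E3] := runs_seq (runs_hd s3) (runs_tl (hd s3)).
have sh : sz (hd s3) <= m by move: ss3; rewrite /= !sz_Cn; lia.
have [|r3 {}E3] := E3 a N Blank; first by lia.
exists r3.
apply: (RunSSeq (RunSSeq (peek_run _ (runs_tl s) _) (RunSSeq H (unpeek_run (e := At c') _) (leqnn _)) (leqnn _)) E3).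
- by lia.
- by rewrite {1}/sz /=; lia.
- by have -> : sz (At c') = 1 by []; rewrite -/K; move: (sz l * K) => X; lia.
Qed.

(** * Polynomial-time tree functions *)

Definition PT (F : tree -> tree) : Prop :=
  exists p q, pol q /\ forall d, runs p d (F d) (q (sz d)).
Definition PT2 (G : tree -> tree -> tree) : Prop := PT (fun d => G (hd d) (tl d)).
Definition PT3 (G : tree -> tree -> tree -> tree) : Prop :=
  PT (fun d => G (hd (hd d)) (tl (hd d)) (tl d)).

Lemma PT_size F : PT F -> exists q, pol q /\ forall d, sz (F d) <= q (sz d).
Proof. by case=> p [q [Hq H]]; exists q; split=> // d; case: (H d). Qed.

Lemma PT_id : PT id.
Proof. by exists SNop, id; split; [exact: pol_id | exact: runs_nop]. Qed.

Lemma PT_app G f : PT G -> PT f -> PT (fun d => G (f d)).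
Proof.
move=> [p [q [Hq H]]] [p' [q' [Hq' H']]].
exists (SSeq p' p), (fun n => q' n + q (q' n)); split; first by pol_tac.
move=> d; apply: runs_le (runs_seq (H' d) (H (f d))) _.
by rewrite leq_add2l; case: Hq => mq _; apply: mq; case: (H' d).
Qed.

Lemma PT_atom a : PT (fun _ => At a).
Proof. by eexists; exists (fun n => 30 * n + 30); split=> [|d]; [pol_tac | exact: runs_atom]. Qed.

Lemma PT_hd f : PT f -> PT (fun d => hd (f d)).
Proof.
apply: PT_app.
by eexists; exists (fun n => 60 * n + 100); split=> [|d]; [pol_tac | exact: runs_hd].
Qed.

Lemma PT_tl f : PT f -> PT (fun d => tl (f d)).
Proof.
apply: PT_app.
by eexists; exists (fun n => 60 * n + 100); split=> [|d]; [pol_tac | exact: runs_tl].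
Qed.

Lemma PT_Cn f g : PT f -> PT g -> PT (fun d => Cn (f d) (g d)).
Proof.
move=> [p [q [Hq H]]] [p' [q' [Hq' H']]].
by eexists; exists (fun n => 100 * n + q n + 30 * q' n + 100); split=> [|d];
  [pol_tac | apply: runs_pair].
Qed.

Lemma PT_app2 G f g : PT2 G -> PT f -> PT g -> PT (fun d => G (f d) (g d)).
Proof. by move=> HG Hf Hg; apply: (PT_app HG (PT_Cn Hf Hg)). Qed.

Definition PTb (b : tree -> bool) : Prop :=
  exists c t, PT c /\ forall d, b d = t (head_sym (c d)).
Definition PTb2 (b : tree -> tree -> bool) : Prop := PTb (fun d => b (hd d) (tl d)).

Lemma PTb_head c t : PT c -> PTb (fun d => t (head_sym (c d))).
Proof. by exists c, t. Qed.

Lemma PT_if b f g : PTb b -> PT f -> PT g -> PT (fun d => if b d then f d else g d).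
Proof.
move=> [c [t [[p [q [Hq H]]] E]]] [pf [qf [Hqf Hf]]] [pg [qg [Hqg Hg]]].
exists (if_prog t p pf pg), (fun n => 50 * n + 30 * q n + (qf n + qg n) + 100); split; first by pol_tac.
move=> d; rewrite E; apply: runs_if => //.
by case: (t _); [apply: runs_le (Hf d) _ | apply: runs_le (Hg d) _]; lia.
Qed.

Lemma PTb_if b b1 b2 : PTb b -> PTb b1 -> PTb b2 -> PTb (fun d => if b d then b1 d else b2 d).
Proof.
have to_tree b' : PTb b' -> PT (fun d => if b' d then At AOpen else At ALeaf).
  by move=> H; apply: PT_if; try exact: PT_atom.
move=> Hb H1 H2.
exists (fun d => if b d then (if b1 d then At AOpen else At ALeaf)
                 else (if b2 d then At AOpen else At ALeaf)), (eq_op^~ SOpen).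
split; first by apply: PT_if => //; apply: to_tree.
by move=> d; case: (b d); [case: (b1 d) | case: (b2 d)].
Qed.

Lemma PTb_not b : PTb b -> PTb (fun d => ~~ b d).
Proof. by move=> [c [t [Hc E]]]; exists c, (fun s => ~~ t s); split=> // d; rewrite E. Qed.

Lemma PTb_const (v : bool) : PTb (fun _ => v).
Proof. by exists id, (fun=> v); split=> //; exact: PT_id. Qed.

Lemma PTb_and b1 b2 : PTb b1 -> PTb b2 -> PTb (fun d => b1 d && b2 d).
Proof. by move=> H1 H2; apply: PTb_if => //; apply: PTb_const. Qed.

Lemma PTb_or b1 b2 : PTb b1 -> PTb b2 -> PTb (fun d => b1 d || b2 d).
Proof. by move=> H1 H2; apply: PTb_if => //; apply: PTb_const. Qed.

Lemma PTb_app2 b f g : PTb2 b -> PT f -> PT g -> PTb (fun d => b (f d) (g d)).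
Proof.
move=> [c [t [Hc E]]] Hf Hg; exists (fun d => c (Cn (f d) (g d))), t; split.
  by apply: PT_app => //; apply: PT_Cn.
by move=> d; rewrite -E.
Qed.

Lemma pol_fold_cost q a b : pol q ->
  pol (fun n => n * (q (n + 2) + a * (n + 2) + a) + b * (n + 2) + b).
Proof. by move=> Hq; pol_tac. Qed.

Section Fold.
Variable G : tree -> tree -> tree -> tree.

Fixpoint foldG (e acc l : tree) : tree :=
  if l is Cn x l' then foldG e (G e acc x) l' else acc.

Let F s := G (hd (hd s)) (tl (hd s)) (tl s).

Lemma foldG_T e acc l : foldG e acc l = foldT F e acc l.
Proof. by elim: l acc => //= x _ l IH acc. Qed.

Lemma PT_fold_step : PT3 G -> exists p q, pol q /\ forall s, runs p s (fold_step F s) (q (sz s)).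
Proof.
move=> HF; apply: PT_Cn; last by do 2!apply: PT_tl; apply: PT_id.
apply: PT_Cn; first by do 2!apply: PT_hd; apply: PT_id.
apply: (PT_app HF); apply: PT_Cn; first by apply: PT_hd; apply: PT_id.
by apply: PT_hd; apply: PT_tl; apply: PT_id.
Qed.

(** The bound [M] remains a parameter for the two folds whose growth depends on the accumulator: the
    parser, which copies the current address into its output, and the pass over the first tree. *)
Lemma foldG_runs : PT3 G -> exists p q, pol q /\ forall e acc l M,
  acc_le F e M acc l ->
  runs p (Cn (Cn e acc) l) (foldG e acc l) (q (sz e + M + sz l)).
Proof.
move=> /PT_fold_step [p [q [Hq H]]].
exists (fold_prog p), (fun n => n * (q (n + 2) + 500 * (n + 2) + 500) + 1000 * (n + 2) + 1000).
split; first exact: pol_fold_cost.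
move=> e acc l M Hacc; rewrite foldG_T.
apply: (runs_le (runs_fold (proj1 Hq) H Hacc)) => /=.
rewrite !leq_add2r leq_mul2r; apply/orP; right; lia.
Qed.

(* The accumulators stay polynomial because what one step adds is bounded
   independently of the accumulator. *)
Lemma PT_fold H E A L : PT3 G -> PT2 H ->
  (forall e acc x, sz (G e acc x) <= sz acc + sz (H e x)) ->
  PT E -> PT A -> PT L -> PT (fun d => foldG (E d) (A d) (L d)).
Proof.
move=> HG HH grow HE HA HL.
have [p [q [Hq Hp]]] := foldG_runs HG.
have [qh [Hqh Hh]] := PT_size HH.
(* Keeping [k] fixed while [l] shrinks makes the allowance for one step the same throughout the
   induction. *)
have Hacc e l acc k : sz l <= k -> acc_le F e (sz acc + sz l * qh (sz e + k + 1)) acc l.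
  elim: l acc => [c|x _ l IH] acc lek /=; split=> //; try exact: leq_addr.
  rewrite sz_Cn in lek *.
  have IH' := IH (G e acc x) ltac:(lia).
  have mono M M' a t : acc_le F e M a t -> M <= M' -> acc_le F e M' a t.
    by move=> + le; elim: t a => [?|? _ t IHt] a /= [? ?]; split=> //; try lia; apply: IHt.
  apply: mono IH' _.
  have : sz (H e x) <= qh (sz e + k + 1).
    by apply: leq_trans (Hh (Cn e x)) _; case: Hqh => mq _; apply: mq; rewrite sz_Cn; lia.
  by have := grow e acc x; nia.
have [pd [qd [Hqd Hpd]]] := PT_Cn (PT_Cn HE HA) HL.
exists (SSeq pd p), (fun n => qd n + q (qd n + (qd n + qd n * qh (qd n + 1)) + qd n)); split.
  apply: pol_add => //; apply: (pol_comp Hq).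
  do !(apply: pol_add || apply: pol_mul || exact: Hqd || exact: pol_const).
  by apply: (pol_comp Hqh); pol_tac.
move=> d; apply: (runs_le (runs_seq (Hpd d) (Hp _ _ _ _ (Hacc _ _ _ _ (leqnn _))))).
rewrite leq_add2l; apply: (proj1 Hq).
have [le _] := Hpd d; rewrite !sz_Cn in le.
have le1 : qh (sz (E d) + sz (L d) + 1) <= qh (qd (sz d) + 1) by apply: (proj1 Hqh); lia.
by nia.
Qed.
End Fold.

Arguments PT_fold {G} H {E A L}.

Ltac pt := repeat first
  [ assumption | exact: PT_id | exact: PT_atom
  | match goal with H : PT2 ?G |- PT (fun d => ?G _ _) => apply: (PT_app2 H) end
  | match goal with H : PTb2 ?G |- PTb (fun d => ?G _ _) => apply: (PTb_app2 H) end
  | match goal with |- PTb (fun d => head_sym _ == ?s) => apply: (@PTb_head _ (eq_op^~ s)) end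
  | apply: PT_hd | apply: PT_tl | apply: PT_Cn | apply: PT_if
  | apply: PTb_and | apply: PTb_or | apply: PTb_not | apply: PTb_if ].

(** * List operations on trees *)

Notation tnil := (At ALeaf).
Definition isnil t := head_sym t == SLeaf.

Definition catrev_t x y := foldG (fun _ acc a => Cn a acc) tnil y x.
Definition cat_t x y := catrev_t (catrev_t x tnil) y.

Lemma sz_catrev x y : sz (catrev_t x y) < sz x + sz y.
Proof.
rewrite /catrev_t; elim: x y => [c|u _ v IH] y //=.
by have := IH (Cn u y); rewrite !sz_Cn; lia.
Qed.

Lemma PT2_catrev : PT2 catrev_t.
Proof.
apply: (PT_fold (fun e x => Cn x tnil)); rewrite /PT2 /PT3; pt.
by move=> e acc x; rewrite !sz_Cn; lia.
Qed.

Lemma sz_cat x y : sz (cat_t x y) <= sz x + sz y.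
Proof.
have := sz_catrev (catrev_t x tnil) y; have := sz_catrev x tnil.
by rewrite /cat_t; have -> : sz tnil = 1 by []; lia.
Qed.

Lemma PT2_cat : PT2 cat_t.
Proof.
apply: (PT_app2 PT2_catrev); last by pt.
by apply: (PT_app2 PT2_catrev); pt.
Qed.

Definition all_t (b : tree -> tree -> bool) e l :=
  head_sym (foldG (fun e acc r => if b e r then acc else At AClose) e tnil l) != SClose.

Lemma PTb2_all b : PTb2 b -> PTb2 (all_t b).
Proof.
move=> Hb; rewrite /PTb2 /all_t; apply: (@PTb_head _ (fun s => s != SClose)).
apply: (PT_fold (fun _ _ => tnil)); rewrite /PT2 /PT3; pt.
by move=> e acc x; case: ifP => _; [lia | have := sz_gt0 acc; rewrite /sz /=; lia].
Qed.

Definition flatmap_t (G : tree -> tree -> tree) e l :=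
  foldG (fun e acc x => catrev_t (G e x) acc) e tnil l.

Lemma PT2_flatmap G : PT2 G -> PT2 (flatmap_t G).
Proof.
move=> HG; apply: (PT_fold G); rewrite /PT2 /PT3; pt.
  by apply: (PT_app2 PT2_catrev); pt.
by move=> e acc x; have := sz_catrev (G e x) acc; lia.
Qed.

Definition first_t (b : tree -> tree -> bool) (G : tree -> tree -> tree) e l :=
  foldG (fun e acc x => if isnil acc && b e x then G e x else acc) e tnil l.

Lemma PT2_first b G : PTb2 b -> PT2 G -> PT2 (first_t b G).
Proof.
move=> Hb HG; apply: (PT_fold G); rewrite /PT2 /PT3 /isnil; pt.
by move=> e acc x; case: ifP => _; lia.
Qed.

(** * The algorithm *)

Definition enc_list (T : Type) (e : T -> tree) (l : seq T) : tree :=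
  foldr (fun x t => Cn (e x) t) tnil l.

Lemma foldG_enc T (G : tree -> tree -> tree -> tree) (f : T -> tree) e acc l :
  foldG G e acc (enc_list f l) = foldl (fun acc x => G e acc (f x)) acc l.
Proof. by elim: l acc => //= x l IH acc. Qed.

Lemma isnil_enc T (f : T -> tree) l : isnil (enc_list f l) = nilp l.
Proof. by case: l. Qed.

Lemma tl_enc T (f : T -> tree) l : tl (enc_list f l) = enc_list f (behead l).
Proof. by case: l. Qed.

Lemma catrev_enc T (f : T -> tree) x y :
  catrev_t (enc_list f x) (enc_list f y) = enc_list f (catrev x y).
Proof. by rewrite /catrev_t foldG_enc; elim: x y => //= a x IH y; rewrite -IH. Qed.

Lemma cat_enc T (f : T -> tree) x y :
  cat_t (enc_list f x) (enc_list f y) = enc_list f (x ++ y).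
Proof.
by rewrite /cat_t -[tnil]/(enc_list f [::]) !catrev_enc !catrevE cats0 revK.
Qed.

Lemma enc_list_map T U (f : U -> tree) (g : T -> U) l :
  enc_list f (map g l) = enc_list (f \o g) l.
Proof. by elim: l => //= x l ->. Qed.

Lemma all_enc T (f : T -> tree) b e l :
  all_t b e (enc_list f l) = all (fun x => b e (f x)) l.
Proof.
rewrite /all_t foldG_enc.
have gen acc : head_sym (foldl (fun acc x => if b e (f x) then acc else At AClose) acc l) != SClose
  = (head_sym acc != SClose) && all (fun x => b e (f x)) l.
  elim: l acc => [|x l IH] acc /=; first by rewrite andbT.
  by rewrite IH; case: (b e (f x)) => //=; rewrite andbF.
by rewrite gen.
Qed.

(** The reversed order mirrors [flatmap_t] exactly. The correctness proof uses only membership in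
    the result, the size estimates only its length. *)
Definition flatmap (T U : Type) (g : T -> seq U) (l : seq T) : seq U :=
  foldl (fun acc x => catrev (g x) acc) [::] l.

Lemma flatmap_enc T U (f : T -> tree) (f' : U -> tree) G e (g : T -> seq U) l :
  (forall x, G e (f x) = enc_list f' (g x)) ->
  flatmap_t G e (enc_list f l) = enc_list f' (flatmap g l).
Proof.
move=> H; rewrite /flatmap_t foldG_enc /flatmap -[tnil]/(enc_list f' [::]).
by elim: l [::] => //= x l IH acc; rewrite H catrev_enc IH.
Qed.

Lemma mem_flatmap (T U : eqType) (g : T -> seq U) l y :
  reflect (exists2 x, x \in l & y \in g x) (y \in flatmap g l).
Proof.
have -> : (y \in flatmap g l) = has (fun x => y \in g x) l.
  rewrite /flatmap; have -> : has (fun x => y \in g x) l = has (fun x => y \in g x) l || (y \in [::]).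
    by rewrite orbF.
  elim: l [::] => //= x l IH acc.
  by rewrite IH catrevE mem_cat mem_rev orbA [_ || (y \in g x)]orbC.
exact: hasP.
Qed.

Lemma size_flatmap T U (g : T -> seq U) l : size (flatmap g l) = sumn [seq size (g x) | x <- l].
Proof.
rewrite /flatmap -[RHS]addn0 -[X in _ = _ + X]/(size ([::] : seq U)).
by elim: l [::] => //= x l IH acc; rewrite IH catrevE size_cat size_rev addnCA addnA.
Qed.

Lemma size_flatmap_le T U (g : T -> seq U) l m :
  (forall x, size (g x) <= m) -> size (flatmap g l) <= size l * m.
Proof.
move=> H; rewrite size_flatmap; elim: l => //= x l IH.
by rewrite mulSn leq_add.
Qed.

(** An empty accumulator means that there has been no hit yet, so a hit has to produce a nonempty
    tree: this is the hypothesis on [G]. *)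
Lemma first_enc T (f : T -> tree) b G e l :
  (forall x, isnil (G e (f x)) = false) ->
  first_t b G e (enc_list f l) =
    if [seq x <- l | b e (f x)] is x :: _ then G e (f x) else tnil.
Proof.
move=> H; rewrite /first_t foldG_enc.
set h := fun acc x => _.
have stay acc : isnil acc = false -> foldl h acc l = acc.
  by move=> Hacc; elim: l => //= x l IH; rewrite /h Hacc.
elim: l stay => //= x l IH stay.
rewrite {2}/h /=; case: (b e (f x)).
  by have := stay _ (H x); rewrite /= {2}/h H.
apply: IH => acc Hacc; have := stay _ Hacc.
by rewrite /= {2}/h Hacc.
Qed.

(* An address as a string: [true] for a unary digit, [false] for the end of a number. *)
Notation addr := (seq nat).
Definition addr_str (a : addr) : seq bool := flatten [seq rcons (nseq i true) false | i <- a].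
(** [SOne] marks pairs and is not an atom, so [AOpen] stands in for a unary digit until [atom_out]
    restores it. [AClose] stays free as a failure flag and as the end mark of an address. *)
Definition bool_atom (b : bool) : atom := if b then AOpen else ASep.
Definition enc_str (s : seq bool) : tree := enc_list (fun b => At (bool_atom b)) s.
Definition enc_address (a : addr) : tree := enc_str (addr_str a).

Lemma addr_str_cons i a : addr_str (i :: a) = nseq i true ++ false :: addr_str a.
Proof. by rewrite /addr_str /= cat_rcons. Qed.

Lemma addr_str_rcons a i : addr_str (rcons a i) = addr_str a ++ rcons (nseq i true) false.
Proof. by rewrite /addr_str map_rcons flatten_rcons. Qed.

(** Every number ends with [false], so no code of a number is a proper prefix of another and a match
    cannot end inside a number. *)
Lemma prefix_addr_str a b : prefix (addr_str a) (addr_str b) = prefix a b.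
Proof.
elim: a b => [|i a IH] [|j b]; rewrite ?prefix0s //.
  by rewrite addr_str_cons; case: i.
rewrite !addr_str_cons [RHS]/= -IH {IH}.
by elim: i j => [|i IH] [|j] //=; rewrite eqSS -IH.
Qed.

Lemma nilp_addr_str a : nilp (addr_str a) = nilp a.
Proof. by case: a => // i a; rewrite addr_str_cons; case: i. Qed.

(** The accumulator is the part of the second string still to be matched. The flag [AClose] for a
    mismatch is not a pair, so all later steps keep it. *)
Definition prefix_step (acc a : tree) : tree :=
  if (head_sym acc == SOne) &&
     (if head_sym a == SOpen then head_sym (hd acc) == SOpen else head_sym (hd acc) == SSep)
  then tl acc else At AClose.
Definition prefix_t x y := head_sym (foldG (fun _ acc a => prefix_step acc a) tnil y x) != SClose.

Lemma PTb2_prefix : PTb2 prefix_t.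
Proof.
rewrite /PTb2 /prefix_t; apply: (@PTb_head _ (fun s => s != SClose)).
apply: (PT_fold (fun _ _ => tnil)); rewrite /PT2 /PT3 /prefix_step; pt.
move=> _ acc x; have gt0 := sz_gt0 acc; case: ifP => _.
  by case: acc {gt0} => //= u v; rewrite sz_Cn; lia.
by rewrite {1}/sz /=; lia.
Qed.

Lemma prefix_enc s t : prefix_t (enc_str s) (enc_str t) = prefix s t.
Proof.
rewrite /prefix_t foldG_enc.
set h := fun acc x => _.
have stuck : foldl h (At AClose) s = At AClose by elim: s.
elim: s t stuck => [|b s IH] t stuck /=; first by rewrite prefix0s; case: t {stuck}.
have {}stuck : foldl h (At AClose) s = At AClose by [].
case: t => [|c t]; rewrite {2}/h /prefix_step /=; first by rewrite stuck.
case: b c => -[] /=; rewrite ?stuck ?IH //.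
Qed.

Lemma prefix_address a b : prefix_t (enc_address a) (enc_address b) = prefix a b.
Proof. by rewrite prefix_enc prefix_addr_str. Qed.

Definition incomparable (a b : addr) : bool := ~~ prefix a b && ~~ prefix b a.
Definition below (a b : addr) : bool := prefix a b && ~~ prefix b a.
Definition incomparable_t a b := ~~ prefix_t a b && ~~ prefix_t b a.
Definition below_t a b := prefix_t a b && ~~ prefix_t b a.

Lemma PTb2_incomparable : PTb2 incomparable_t.
Proof. by have H := PTb2_prefix; rewrite /PTb2 /incomparable_t; pt. Qed.

Lemma PTb2_below : PTb2 below_t.
Proof. by have H := PTb2_prefix; rewrite /PTb2 /below_t; pt. Qed.

Definition enc_addrs : seq addr -> tree := enc_list enc_address.

Lemma hd_enc_addrs L : hd (enc_addrs L) = enc_address (head [::] L).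
Proof. by case: L. Qed.

(* A partial embedding of the children of a node: the images of the children
   treated so far, and the images of all nodes of their subtrees. *)
Definition item : Type := (seq addr * seq addr)%type.
Definition enc_item (x : item) : tree := Cn (enc_addrs x.1) (enc_addrs x.2).
Definition enc_items : seq item -> tree := enc_list enc_item.

Definition node : Type := (addr * bool)%type.
Definition enc_node (w : node) : tree :=
  Cn (enc_address w.1) (At (if w.2 then AOpen else ALeaf)).

(** The head of [L] is the image of the root of the new child. [L] goes in front because children
    are added from last to first. *)
Definition extend (L : seq addr) (x : item) : seq item :=
  if all (incomparable (head [::] L)) x.1 then [:: (head [::] L :: x.1, L ++ x.2)] else [::].
Definition join_items (C : seq (seq addr)) (P : seq item) : seq item :=
  flatmap (fun L => flatmap (extend L) P) C.

Definition extend_t L x :=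
  if all_t incomparable_t (hd L) (hd x)
  then Cn (Cn (Cn (hd L) (hd x)) (cat_t L (tl x))) tnil else tnil.
Definition merge_t C P := flatmap_t (fun P L => flatmap_t extend_t L P) P C.

Lemma PT2_merge : PT2 merge_t.
Proof.
have Hall := PTb2_all PTb2_incomparable; have Hcat := PT2_cat.
have Hext : PT2 extend_t by rewrite /PT2 /extend_t; pt.
have Hfm := PT2_flatmap Hext.
have Hfm2 : PT2 (flatmap_t (fun P L => flatmap_t extend_t L P)).
  by apply: PT2_flatmap; rewrite /PT2; pt.
by rewrite /PT2 /merge_t; pt.
Qed.

Lemma merge_enc C P :
  merge_t (enc_list enc_addrs C) (enc_items P) = enc_items (join_items C P).
Proof.
apply: flatmap_enc => L; apply: flatmap_enc => x.
rewrite /extend_t /extend hd_enc_addrs /= all_enc.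
rewrite (eq_all (a2 := incomparable (head [::] L))); last first.
  by move=> a; rewrite /incomparable_t /incomparable !prefix_address.
by case: ifP => // _; rewrite /enc_addrs cat_enc.
Qed.

(** An inner node may be sent to any node, so a node without children may even land on a leaf; only
    [leaf_column] looks at the kind of the target. *)
Definition place (P : seq item) (w : node) : seq (seq addr) :=
  if [seq x <- P | all (below w.1) x.1] is x :: _ then [:: w.1 :: x.2] else [::].
Definition column (P : seq item) (ns : seq node) : seq (seq addr) := flatmap (place P) ns.

Definition place_t P w :=
  first_t (fun a x => all_t below_t a (hd x)) (fun a x => Cn (Cn a (tl x)) tnil) (hd w) P.
Definition column_t P ns := flatmap_t place_t P ns.

Lemma PT2_column : PT2 column_t.
Proof.
have Hall := PTb2_all PTb2_below.
have Hfirst : PT2 (first_t (fun a x => all_t below_t a (hd x)) (fun a x => Cn (Cn a (tl x)) tnil)).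
  by apply: PT2_first; rewrite /PTb2 /PT2; pt.
by apply: PT2_flatmap; rewrite /PT2 /place_t; pt.
Qed.

Lemma column_enc P ns :
  column_t (enc_items P) (enc_list enc_node ns) = enc_list enc_addrs (column P ns).
Proof.
apply: flatmap_enc => w; rewrite /place_t first_enc // /place.
rewrite (eq_filter (a2 := fun x => all (below w.1) x.1)); last first.
  move=> x; rewrite all_enc; apply: eq_all => a.
  by rewrite /below_t /below !prefix_address.
by case: (filter _ _).
Qed.

Definition leaf_column (ns : seq node) : seq (seq addr) :=
  flatmap (fun w : node => if w.2 then [:: [:: w.1]] else [::]) ns.
Definition leaf_column_t ns :=
  flatmap_t (fun _ w => if head_sym (tl w) == SOpen then Cn (Cn (hd w) tnil) tnil else tnil) tnil ns.

Lemma PT_leaf_column f : PT f -> PT (fun d => leaf_column_t (f d)).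
Proof.
move=> Hf; rewrite /leaf_column_t.
have H : PT2 (flatmap_t (fun _ w => if head_sym (tl w) == SOpen then Cn (Cn (hd w) tnil) tnil else tnil)).
  by apply: PT2_flatmap; rewrite /PT2; pt.
by pt.
Qed.

Lemma leaf_column_enc ns :
  leaf_column_t (enc_list enc_node ns) = enc_list enc_addrs (leaf_column ns).
Proof. by apply: flatmap_enc => -[w []]. Qed.

Definition init_items : seq item := [:: ([::], [::])].

(* The code of the first tree is read from right to left, with a stack holding
   one list of items for each node whose children are being read. *)
Definition col_step (ns : seq node) (st : seq (seq item)) (s : sym) : seq (seq item) :=
  if s == SClose then init_items :: st
  else if s == SLeaf then join_items (leaf_column ns) (head [::] st) :: behead st
  else join_items (column (head [::] st) ns) (head [::] (behead st)) :: behead (behead st).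

Definition col_step_t ns st x :=
  if head_sym x == SClose then Cn (Cn (Cn tnil tnil) tnil) st
  else if head_sym x == SLeaf then Cn (merge_t (leaf_column_t ns) (hd st)) (tl st)
  else Cn (merge_t (column_t (hd st) ns) (hd (tl st))) (tl (tl st)).

Lemma PT3_col_step : PT3 col_step_t.
Proof.
have H1 := PT2_merge; have H2 := PT2_column.
rewrite /PT3 /col_step_t; pt.
by apply: PT_leaf_column; pt.
Qed.

Definition sym_atom (s : sym) : atom :=
  match s with SLeaf => ALeaf | SOpen => AOpen | SClose => AClose | _ => ASep end.
Definition enc_sym (s : sym) : tree := At (sym_atom s).
Definition enc_stack : seq (seq item) -> tree := enc_list enc_items.

Lemma hd_enc_stack st : hd (enc_stack st) = enc_items (head [::] st).
Proof. by case: st. Qed.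

Lemma col_step_enc ns st s :
  col_step_t (enc_list enc_node ns) (enc_stack st) (enc_sym s) = enc_stack (col_step ns st s).
Proof.
rewrite /col_step_t /col_step hd_enc_stack leaf_column_enc.
rewrite column_enc merge_enc tl_enc -/enc_stack hd_enc_stack merge_enc tl_enc.
by case: s.
Qed.

(* State of the reader: the code of the first tree, reversed; whether the
   separator has been read; the address of the node to come in the second tree, as
   a reversed string; those of its ancestors; the nodes found so far. *)
Definition pstate : Type :=
  (seq sym * bool * seq bool * seq (seq bool) * seq (seq bool * bool))%type.

(** In a reversed string the last number stands in front; adding 1 to it inserts a digit behind its
    end mark. After the root the value is meaningless, but the code has then been read
    completely. *)
Definition next_sibling (r : seq bool) : seq bool := false :: true :: behead r.

Definition parse_step (x : pstate) (s : sym) : pstate :=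
  let: (u, m, r, k, o) := x in
  if m then
    if s == SLeaf then (u, m, next_sibling r, k, (rev r, true) :: o)
    else if s == SOpen then (u, m, false :: true :: r, r :: k, (rev r, false) :: o)
    else (u, m, next_sibling (head [::] k), behead k, o)
  else if s == SSep then (u, true, r, k, o) else (s :: u, m, r, k, o).

Definition enc_bool (b : bool) : tree := At (if b then AOpen else ALeaf).
Definition enc_snode (w : seq bool * bool) : tree := Cn (enc_str w.1) (enc_bool w.2).
Definition enc_pstate (x : pstate) : tree :=
  let: (u, m, r, k, o) := x in
  Cn (enc_list enc_sym u) (Cn (enc_bool m) (Cn (enc_str r)
    (Cn (enc_list enc_str k) (enc_list enc_snode o)))).

Definition next_sibling_t r := Cn (At ASep) (Cn (At AOpen) (tl r)).

Definition parse_step_t (_ st x : tree) : tree :=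
  let u := hd st in let m := hd (tl st) in let r := hd (tl (tl st)) in
  let k := hd (tl (tl (tl st))) in let o := tl (tl (tl (tl st))) in
  if head_sym m == SOpen then
    if head_sym x == SLeaf then
      Cn u (Cn m (Cn (next_sibling_t r) (Cn k (Cn (Cn (catrev_t r tnil) (At AOpen)) o))))
    else if head_sym x == SOpen then
      Cn u (Cn m (Cn (Cn (At ASep) (Cn (At AOpen) r))
        (Cn (Cn r k) (Cn (Cn (catrev_t r tnil) tnil) o))))
    else Cn u (Cn m (Cn (next_sibling_t (hd k)) (Cn (tl k) o)))
  else if head_sym x == SSep then Cn u (Cn (At AOpen) (Cn r (Cn k o)))
  else Cn (Cn x u) (Cn m (Cn r (Cn k o))).

Lemma PT3_parse_step : PT3 parse_step_t.
Proof.
have H := PT2_catrev; rewrite /PT3 /parse_step_t /next_sibling_t; pt.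
Qed.

Definition input_sym (s : sym) : bool := s \in [:: SLeaf; SOpen; SClose; SSep].

Lemma parse_step_enc e x s : input_sym s ->
  parse_step_t e (enc_pstate x) (enc_sym s) = enc_pstate (parse_step x s).
Proof.
case: x => [[[[u m] r] k] o].
have Hr : catrev_t (enc_str r) tnil = enc_str (rev r).
  by rewrite -[tnil]/(enc_str [::]) catrev_enc.
have Hn t : next_sibling_t (enc_str t) = enc_str (next_sibling t).
  by rewrite /next_sibling_t tl_enc.
have Hk : hd (enc_list enc_str k) = enc_str (head [::] k) by case: k.
rewrite /parse_step_t /= Hr Hn Hk Hn tl_enc.
by case: m; case: s.
Qed.

(** The pass ends with items for the one-tree forest of the whole first tree, so [x.1] holds just
    the image of its root, which has to be the empty address. *)
Definition root_images_step (acc : seq addr) (x : item) : seq addr :=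
  if nilp acc && nilp (head [::] x.1) then x.2 else acc.
Definition root_images (P : seq item) : seq addr := foldl root_images_step [::] P.

Definition root_images_t P :=
  foldG (fun _ acc x => if isnil acc && isnil (hd (hd x)) then tl x else acc) tnil tnil P.

Lemma PT_root_images f : PT f -> PT (fun d => root_images_t (f d)).
Proof.
move=> Hf; apply: (PT_fold (fun _ x => x)); rewrite /PT2 /PT3 /isnil; pt.
by move=> e acc x; case: ifP => _; [case: x => [?|? ?]; rewrite /= ?sz_Cn|]; lia.
Qed.

Lemma isnil_address a : isnil (enc_address a) = nilp a.
Proof. by rewrite isnil_enc nilp_addr_str. Qed.

Lemma root_images_enc P : root_images_t (enc_items P) = enc_addrs (root_images P).
Proof.
rewrite /root_images_t foldG_enc /root_images -[X in foldl _ X]/(enc_addrs [::]).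
elim: P [::] => //= x P IH acc; rewrite -IH; congr (foldl _ _ P).
rewrite isnil_enc hd_enc_addrs isnil_address /root_images_step.
by case: ifP.
Qed.

Definition answer_atoms (L : seq addr) : seq atom :=
  if nilp L then [::]
  else ALeaf :: flatten [seq rcons (map bool_atom (addr_str a)) AClose | a <- L].

Definition answer_t L :=
  if isnil L then tnil
  else Cn tnil (foldG (fun _ acc a => cat_t a (Cn (At AClose) acc)) tnil tnil (catrev_t L tnil)).

Lemma PT_answer f : PT f -> PT (fun d => answer_t (f d)).
Proof.
move=> Hf; have H1 := PT2_catrev; have H2 := PT2_cat.
rewrite /answer_t /isnil; pt.
apply: (PT_fold (fun _ x => Cn x tnil)); rewrite /PT2 /PT3; pt.
move=> e acc x; apply: leq_trans (sz_cat _ _) _; rewrite !sz_Cn /sz /=; lia.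
Qed.

Lemma answer_enc L : answer_t (enc_addrs L) = enc_list At (answer_atoms L).
Proof.
rewrite /answer_t isnil_enc /answer_atoms; case: (nilp L) => //=; congr (Cn _ _).
rewrite -[X in catrev_t _ X]/(enc_addrs [::]) catrev_enc catrevE cats0.
rewrite foldG_enc foldl_rev -[X in foldr _ X]/(enc_list At [::]).
elim: L => //= a L ->.
rewrite cat_rcons -[Cn _ (enc_list _ _)]/(enc_list At (AClose :: _)) -cat_enc enc_list_map.
by [].
Qed.

Definition atom_out (a : atom) : sym := if a is AOpen then SOne else atom_sym a.

Lemma answer_atoms_enc L : ~~ nilp L -> map atom_out (answer_atoms L) = enc_yes L.
Proof.
rewrite /answer_atoms /enc_yes => /negbTE -> /=; congr cons.
rewrite map_flatten -map_comp; congr flatten; apply: eq_map => a /=.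
rewrite map_rcons -cats1 /enc_addr; congr (_ ++ _).
rewrite -map_comp; elim: a => //= i a IH.
by rewrite addr_str_cons map_cat /= IH map_nseq cats1 cat_rcons.
Qed.

(** * Correctness of the algorithm *)

(** The recursion of [Topo] passes through [seq], so the hypothesis for the children has to be
    supplied by hand; indices match the use of [nth] in [subtree]. *)
Lemma Topo_nth_ind (P : Topo -> Prop) : P Leaf ->
  (forall ts, (forall i, i < size ts -> P (nth Leaf ts i)) -> P (Node ts)) ->
  forall t, P t.
Proof.
move=> HL HN; fix IH 1 => t; case: t => [|ts]; first exact: HL.
apply: HN; elim: ts => [|t ts IHts] [|i] lt; first by [].
- by [].
- exact: (IH t).
- exact: (IHts i lt).
Qed.

Definition forest_code (ts : seq Topo) : seq sym := flatten (map code ts).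

Lemma code_Node ts : code (Node ts) = SOpen :: rcons (forest_code ts) SClose.
Proof. by rewrite -cats1 /=; congr (_ :: _ ++ _); elim: ts => //= t ts ->. Qed.

Fixpoint forest_addrs (i : nat) (ts : seq Topo) : seq addr :=
  if ts is t :: ts' then map (cons i) (addrs t) ++ forest_addrs i.+1 ts' else [::].

Lemma addrs_Node ts : addrs (Node ts) = [::] :: forest_addrs 1 ts.
Proof. by rewrite /=; congr cons; elim: ts 1 => //= t ts IH i; rewrite IH. Qed.

(** Children are numbered from [i], so that an induction along a forest can pass to its tail at
    [i.+1]. *)
Definition forest_subtree (i : nat) (ts : seq Topo) (a : addr) : option Topo :=
  if a is j :: a' then
    if i <= j < i + size ts then subtree (nth Leaf ts (j - i)) a' else None
  else None.

Lemma subtree_Node ts j a : subtree (Node ts) (j :: a) = forest_subtree 1 ts (j :: a).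
Proof.
rewrite /= add1n ltnS; case: ifP => // /andP[? ?]; congr (subtree (nth _ _ _) _); lia.
Qed.

Lemma forest_subtree_cons i t ts j a : forest_subtree i (t :: ts) (j :: a) =
  if j == i then subtree t a else forest_subtree i.+1 ts (j :: a).
Proof.
rewrite /=; case: eqP => [->|ne]; first by rewrite subnn leqnn ifT //; lia.
have -> : (i <= j < i + (size ts).+1) = (i < j < i.+1 + size ts) by lia.
by case: ifP => // /andP[lt _]; rewrite -(subnSK lt).
Qed.

Lemma mem_forest_addrs i ts :
  (forall k, k < size ts -> forall a, a \in addrs (nth Leaf ts k) <-> Addr (nth Leaf ts k) a) ->
  forall a, a \in forest_addrs i ts <-> forest_subtree i ts a <> None.
Proof.
elim: ts i => [|t ts IH] i H [|j a] //=.
- by split=> //; rewrite addn0; case: ifP => //; lia.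
- rewrite mem_cat; split=> // /orP[/mapP[]//|].
  by move/(IH i.+1 (fun k => H k.+1)).
rewrite -[X in _ <-> X <> _]/(forest_subtree i (t :: ts) (j :: a)) forest_subtree_cons mem_cat.
have H0 := H 0 isT a; have IH' := IH i.+1 (fun k => H k.+1) (j :: a).
case: eqP => [->|ne].
  split=> [/orP[/mapP[b Hb [->]]|]|Ha].
  - exact/(H 0 isT b).
  - move/(IH i.+1 (fun k => H k.+1)) => /=; case: ifP => //; lia.
  - by apply/orP; left; rewrite map_f //; apply/H0.
split=> [/orP[/mapP[b _ []//]|/IH'//]|/IH' ->]; by rewrite orbT.
Qed.

Lemma mem_addrs t a : a \in addrs t <-> Addr t a.
Proof.
elim/Topo_nth_ind: t a => [|ts IH] a; first by case: a.
rewrite addrs_Node in_cons /Addr; case: a => [|j a] //.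
by rewrite subtree_Node; apply: mem_forest_addrs.
Qed.

(** Used in contrapositive form: below incomparable addresses there is no common descendant. *)
Lemma prefix_comparable (a b c : addr) : prefix a c -> prefix b c -> prefix a b || prefix b a.
Proof.
elim: a b c => [|x a IH] [|y b] [|z c] //=; rewrite ?prefix0s //.
move=> /andP[/eqP-> Ha] /andP[/eqP-> Hb]; rewrite !eqxx; exact: IH Ha Hb.
Qed.

Lemma prefix_asym (a b : addr) : prefix a b -> prefix b a -> a = b.
Proof.
elim: a b => [|x a IH] [|y b] //= /andP[/eqP-> Ha] /andP[_ Hb].
by rewrite (IH b).
Qed.

Definition isLeaf (t : Topo) : bool := if t is Leaf then true else false.

(** The order is the reverse of prefix order, since the parser puts each node it meets in front of
    the earlier ones. *)
Fixpoint nodes_at (p : addr) (t : Topo) : seq node :=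
  match t with
  | Leaf => [:: (p, true)]
  | Node ts => (fix go (i : nat) (us : seq Topo) : seq node :=
      match us with
      | [::] => [::]
      | u :: us' => go i.+1 us' ++ nodes_at (rcons p i) u
      end) 1 ts ++ [:: (p, false)]
  end.

Fixpoint forest_nodes (p : addr) (i : nat) (us : seq Topo) : seq node :=
  if us is u :: us' then forest_nodes p i.+1 us' ++ nodes_at (rcons p i) u else [::].

Lemma nodes_at_Node p ts : nodes_at p (Node ts) = rcons (forest_nodes p 1 ts) (p, false).
Proof. by rewrite -cats1 /=; congr (_ ++ _); elim: ts 1 => //= t ts IH i; rewrite IH. Qed.

Lemma mem_nodes_at p t q b :
  (q, b) \in nodes_at p t <->
  exists a u, [/\ q = p ++ a, subtree t a = Some u & b = isLeaf u].
Proof.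
elim/Topo_nth_ind: t p q b => [|ts IH] p q b.
  split=> [|[[|??] [u [-> //= [<-] ->]]]]; last by rewrite cats0 inE.
  by rewrite inE => /eqP[-> ->]; exists [::], Leaf; rewrite cats0.
rewrite nodes_at_Node mem_rcons in_cons.
have Hf i us : (forall k, k < size us -> forall p q b,
    (q, b) \in nodes_at p (nth Leaf us k) <->
    exists a u, [/\ q = p ++ a, subtree (nth Leaf us k) a = Some u & b = isLeaf u]) ->
  (q, b) \in forest_nodes p i us <->
  exists a u, [/\ q = p ++ a, forest_subtree i us a = Some u & b = isLeaf u].
  elim: us i => [|u us IHus] i H /=.
    split=> // -[[|j a] [u [_ /=]]] //; rewrite addn0; case: ifP => //; lia.
  have H0 : (q, b) \in nodes_at (rcons p i) u <-> exists a v,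
      [/\ q = rcons p i ++ a, subtree u a = Some v & b = isLeaf v] := H 0 isT (rcons p i) q b.
  have {IHus}IHus := IHus i.+1 (fun k => H k.+1).
  rewrite mem_cat; split.
    case/orP=> [/IHus [[|j a] [v [-> //]]]|/H0 [a [v [-> Ha Hb]]]].
      move=> Hv Hb; exists (j :: a), v; split=> //; rewrite forest_subtree_cons ifN //.
      by move: Hv => /=; case: ifP => //; lia.
    exists (i :: a), v; rewrite cat_rcons; split=> //.
    by rewrite forest_subtree_cons eqxx.
  case=> -[|j a] [v [Eq //]]; rewrite forest_subtree_cons.
  case: eqP Eq => [->|ne] Eq Hv Hb; apply/orP; [right; apply/H0 | left; apply/IHus].
    by exists a, v; rewrite cat_rcons.
  by exists (j :: a), v.
have {}Hf := Hf 1 ts IH; split.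
  case/orP=> [/eqP[-> ->]|/Hf [[|j a] [u [-> //]]]].
    by exists [::], (Node ts); rewrite cats0.
  by exists (j :: a), u; rewrite subtree_Node.
case=> -[|j a] [u [Eq Hu Hb]].
  by move: Hu Hb => [<-] ->; rewrite Eq cats0 eqxx.
by apply/orP; right; apply/Hf; exists (j :: a), u; rewrite -subtree_Node.
Qed.

Fixpoint embedding_lists (ns : seq node) (t : Topo) : seq (seq addr) :=
  match t with
  | Leaf => leaf_column ns
  | Node ts =>
      column (foldr (fun u P => join_items (embedding_lists ns u) P) init_items ts) ns
  end.

Definition forest_items (ns : seq node) (ts : seq Topo) : seq item :=
  foldr (fun u P => join_items (embedding_lists ns u) P) init_items ts.

Lemma mem_join_items C P x :
  reflect (exists2 L, L \in C & exists2 y, y \in P &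
             all (incomparable (head [::] L)) y.1 /\ x = (head [::] L :: y.1, L ++ y.2))
          (x \in join_items C P).
Proof.
apply: (iffP (mem_flatmap _ _ _)) => -[L HL].
  case/mem_flatmap=> y Hy; rewrite /extend; case: ifP => // Hall.
  by rewrite inE => /eqP ->; exists L => //; exists y.
case=> y Hy [Hall ->]; exists L => //; apply/mem_flatmap; exists y => //.
by rewrite /extend Hall inE.
Qed.

Lemma mem_column (P : seq item) (ns : seq node) L : L \in column P ns ->
  exists w b x, [/\ (w, b) \in ns, x \in P, all (below w) x.1 & L = w :: x.2].
Proof.
case/mem_flatmap=> -[w b] Hw; rewrite /place.
case E: [seq x <- P | all (below w) x.1] => [|x P'] //=.
rewrite inE => /eqP ->; exists w, b, x.
have : x \in [seq x <- P | all (below w) x.1] by rewrite E mem_head.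
by rewrite mem_filter => /andP[].
Qed.

Lemma column_mem P ns w b x : (w, b) \in ns -> x \in P -> all (below w) x.1 ->
  exists2 L, L \in column P ns & head [::] L = w.
Proof.
move=> Hw Hx Hall.
case E: [seq x <- P | all (below w) x.1] => [|y P'].
  have : x \in [seq x <- P | all (below w) x.1] by rewrite mem_filter Hall.
  by rewrite E.
exists (w :: y.2) => //; apply/mem_flatmap; exists (w, b) => //.
by rewrite /place /= E inE.
Qed.

Section Correctness.
Variable t2 : Topo.
Let ns := nodes_at [::] t2.

(* [L] lists the images of the addresses [A]; [leaf] tells the leaves among [A]. *)
Definition good_images (A : seq addr) (leaf : addr -> Prop) (L : seq addr) : Prop :=
  [/\ size L = size A,
      forall a b, (a, b) \in zip A L -> Addr t2 b,
      forall a b, (a, b) \in zip A L -> leaf a -> subtree t2 b = Some Leaf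
    & forall a b a' b', (a, b) \in zip A L -> (a', b') \in zip A L ->
        prefix a a' = prefix b b'].

Lemma mem_zip_cons (i j : nat) (A L : seq addr) (a b : addr) :
  (j :: a, b) \in zip (map (cons i) A) L <-> j = i /\ (a, b) \in zip A L.
Proof.
elim: A L => [|c A IH] [|l L] //=; try by split=> // -[].
rewrite !in_cons; split.
  case/orP=> [/eqP[-> -> ->]|/IH [-> ->]]; first by rewrite eqxx.
  by rewrite orbT.
case=> Ej /orP[/eqP[-> ->]|H]; first by rewrite Ej eqxx.
by apply/orP; right; apply/IH.
Qed.

(** All images of a child lie below the image of its root, and root images are pairwise
    incomparable; so images from different children are incomparable, as their addresses are. The
    second conclusion carries this through the induction, and later puts all images below the
    parent. *)
Lemma forest_items_sound i ts :
  (forall k, k < size ts -> forall L, L \in embedding_lists ns (nth Leaf ts k) ->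
     good_images (addrs (nth Leaf ts k))
       (fun a => subtree (nth Leaf ts k) a = Some Leaf) L) ->
  forall x, x \in forest_items ns ts ->
  good_images (forest_addrs i ts) (fun a => forest_subtree i ts a = Some Leaf) x.2 /\
  forall a b, (a, b) \in zip (forest_addrs i ts) x.2 ->
    exists2 r, r \in x.1 & prefix r b.
Proof.
elim: ts i => [|t ts IH] i H x.
  by rewrite inE => /eqP -> /=; split.
case/mem_join_items=> L HL [y Hy [Hinc ->]] /=.
have [sL AL LL PL] := H 0 isT L HL.
have [[sy Ay Ly Py] Ry] := IH i.+1 (fun k => H k.+1) y Hy.
have E : zip (map (cons i) (addrs t) ++ forest_addrs i.+1 ts) (L ++ y.2) =
    zip (map (cons i) (addrs t)) L ++ zip (forest_addrs i.+1 ts) y.2.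
  by rewrite zip_cat // size_map sL.
have mem1 a b : (a, b) \in zip (map (cons i) (addrs t)) L ->
    exists2 a', a = i :: a' & (a', b) \in zip (addrs t) L.
  move=> Hab; have := map_f fst Hab.
  rewrite -/(unzip1 _) unzip1_zip ?size_map ?sL //= => /mapP[a' _ Ea]; exists a' => //.
  by move: Hab; rewrite Ea => /mem_zip_cons[].
have mem2 a b : (a, b) \in zip (forest_addrs i.+1 ts) y.2 ->
    exists j a', a = j :: a' /\ i < j.
  move=> Hab; have := map_f fst Hab.
  rewrite -/(unzip1 _) unzip1_zip ?sy //= => /(mem_forest_addrs _ (fun k _ => mem_addrs _)).
  case: (a) => [|j a'] //=; case: ifP => // /andP[lt _] _.
  by exists j, a'.
have head_le a b : (a, b) \in zip (addrs t) L -> prefix (head [::] L) b.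
  move=> Hab; rewrite -(PL [::] _ a b) ?prefix0s //.
  move: sL Hab; case: (t) => [|us]; case: (L) => [|l L'] //= _ _; by rewrite mem_head.
have apart a b a' b' : (a, b) \in zip (addrs t) L ->
    (a', b') \in zip (forest_addrs i.+1 ts) y.2 -> prefix b b' = false /\ prefix b' b = false.
  move=> /head_le Hb /Ry [r /(allP Hinc) /andP[N1 N2] Hr].
  have contra c : prefix (head [::] L) c -> prefix r c -> False.
    by move=> P1 P2; have := prefix_comparable P1 P2; rewrite (negbTE N1) (negbTE N2).
  split; apply/negbTE/negP => Hp.
    by apply: (contra b') => //; apply: prefix_trans Hb Hp.
  by apply: (contra b) => //; apply: prefix_trans Hr Hp.
split; last first.
  move=> a b; rewrite E mem_cat => /orP[/mem1 [a' _ /head_le Hb]|/Ry [r Hr Hb]].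
    by exists (head [::] L); rewrite ?mem_head.
  by exists r => //; rewrite in_cons Hr orbT.
split.
- by rewrite !size_cat size_map sL sy.
- by move=> a b; rewrite E mem_cat => /orP[/mem1 [a' _ /AL]|/Ay].
- move=> a b; rewrite E mem_cat => /orP[/mem1 [a' -> Hb]|Hab].
    by rewrite forest_subtree_cons eqxx; apply: LL Hb.
  have [j [a' [Ea lt]]] := mem2 _ _ Hab.
  by rewrite Ea forest_subtree_cons gtn_eqF // -Ea; apply: Ly Hab.
- move=> a b a' b'; rewrite E !mem_cat.
  case/orP=> [/mem1 [c -> Hc]|Hab] /orP[/mem1 [c' -> Hc']|Hab'].
  + by rewrite /= eqxx; apply: PL.
  + have [j [d [-> lt]]] := mem2 _ _ Hab'.
    by have [-> _] := apart _ _ _ _ Hc Hab'; rewrite /= ltn_eqF.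
  + have [j [d [-> lt]]] := mem2 _ _ Hab.
    by have [_ ->] := apart _ _ _ _ Hc' Hab; rewrite /= gtn_eqF.
  + exact: Py Hab Hab'.
Qed.

Lemma embedding_lists_sound t L : L \in embedding_lists ns t ->
  good_images (addrs t) (fun a => subtree t a = Some Leaf) L.
Proof.
elim/Topo_nth_ind: t L => [|ts IH] L.
  case/mem_flatmap=> -[w []] //= /mem_nodes_at [a [u [-> Hu Eu]]].
  rewrite inE => /eqP -> /=; split=> //.
  - by move=> c b; rewrite inE => /eqP[_ ->]; rewrite /Addr Hu.
  - by move=> c b; rewrite inE => /eqP[_ ->] _; case: (u) Hu Eu.
  - move=> c b c' b'; rewrite !inE => /eqP[-> ->] /eqP[-> ->].
    by rewrite !prefix_refl.
case/mem_column=> w [b [x [Hw Hx Hall ->]]].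
have [[sx Ax Lx Px] Rx] := forest_items_sound 1 IH Hx.
have Hbw a c : (a, c) \in zip (forest_addrs 1 ts) x.2 -> prefix w c /\ prefix c w = false.
  case/Rx=> r /(allP Hall) /andP[P1 N1] P2; split; first exact: prefix_trans P1 P2.
  by apply/negP => P3; rewrite (prefix_trans P2 P3) in N1.
have Hne a c : (a, c) \in zip (forest_addrs 1 ts) x.2 -> exists j d, a = j :: d.
  move=> Hac; have := map_f fst Hac.
  rewrite -/(unzip1 _) unzip1_zip ?sx //= => /(mem_forest_addrs _ (fun k _ => mem_addrs _)).
  by case: (a) => [|j d] // _; exists j, d.
have Aw : Addr t2 w.
  by case/mem_nodes_at: Hw => a [u [-> Hu _]]; rewrite /Addr Hu.
rewrite addrs_Node; split.
- by rewrite /= sx.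
- by move=> a c; rewrite in_cons => /orP[/eqP[_ ->]|/Ax].
- move=> a c; rewrite in_cons => /orP[/eqP[-> _] //|Hac].
  have [j [d Ea]] := Hne _ _ Hac; rewrite Ea subtree_Node -Ea.
  exact: Lx Hac.
- move=> a c a' c'; rewrite !in_cons.
  case/orP=> [/eqP[-> ->]|Hac] /orP[/eqP[-> ->]|Hac'].
  + by rewrite !prefix_refl.
  + by have [-> _] := Hbw _ _ Hac'; rewrite prefix0s.
  + by have [_ ->] := Hbw _ _ Hac; have [j [d ->]] := Hne _ _ Hac.
  + exact: Px Hac Hac'.
Qed.

Definition embeds_at (t : Topo) (w : addr) (f : addr -> addr) : Prop :=
  [/\ (forall a, Addr t a -> Addr t2 (f a)), f [::] = w,
      (forall a, subtree t a = Some Leaf -> subtree t2 (f a) = Some Leaf)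
    & (forall a b, Addr t a -> Addr t b -> prefix a b <-> prefix (f a) (f b))].

Lemma Addr_nodes w : Addr t2 w -> exists2 u, subtree t2 w = Some u & (w, isLeaf u) \in ns.
Proof.
rewrite /Addr; case E: (subtree t2 w) => [u|] // _; exists u => //.
by apply/mem_nodes_at; exists w, u.
Qed.

(** The list found may differ from [f] everywhere except at the root. This is enough for the
    induction, because [incomparable] and [below] are tested only on root images, where the list
    agrees with [f]. *)
Lemma embedding_lists_complete t w f : embeds_at t w f ->
  exists2 L, L \in embedding_lists ns t & head [::] L = w.
Proof.
elim/Topo_nth_ind: t w f => [|ts IH] w f [HA Hw HL HP].
  have Hleaf : subtree t2 w = Some Leaf by rewrite -Hw; apply: HL.
  exists [:: w] => //; apply/mem_flatmap; exists (w, true); last by rewrite /= inE.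
  by apply/mem_nodes_at; exists w, Leaf.
have Hforest us i :
    (forall k, k < size us -> forall w f, embeds_at (nth Leaf us k) w f ->
       exists2 L, L \in embedding_lists ns (nth Leaf us k) & head [::] L = w) ->
    (forall k, k < size us -> embeds_at (nth Leaf us k) (f [:: i + k]) (fun a => f (i + k :: a))) ->
    (forall k l, k < l < size us -> incomparable (f [:: i + k]) (f [:: i + l])) ->
    exists rest, ([seq f [:: j] | j <- iota i (size us)], rest) \in forest_items ns us.
  elim: us i => [|u us IHus] i H1 H2 H3; first by exists [::]; rewrite inE.
  have [|||rest Hrest] := IHus i.+1.
  - by move=> k; apply: (H1 k.+1).
  - by move=> k lt; have := H2 k.+1 lt; rewrite addnS -addSn.
  - by move=> k l lt; have := H3 k.+1 l.+1 lt; rewrite !addnS -!addSn.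
  have [L HL' HhL] := H1 0 isT _ _ (H2 0 isT).
  rewrite addn0 in HhL.
  exists (L ++ rest); apply/mem_join_items; exists L => //.
  exists ([seq f [:: j] | j <- iota i.+1 (size us)], rest) => //=.
  split; last by rewrite /= HhL.
  rewrite HhL; apply/allP => r /mapP[j]; rewrite mem_iota => /andP[lt1 lt2] ->.
  have := H3 0 (j - i); rewrite addn0 subnKC; last exact: ltnW.
  by apply; rewrite /=; lia.
have sub k : k < size ts -> forall a,
    subtree (Node ts) (1 + k :: a) = subtree (nth Leaf ts k) a.
  by move=> lt a; rewrite subtree_Node /= ifT ?addKn //; lia.
have Hchild k : k < size ts -> Addr (Node ts) [:: 1 + k].
  by move=> lt; rewrite /Addr sub.
have [|||rest Hrest] := Hforest ts 1 => //.
- move=> k lt; split=> //.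
  + by move=> a Ha; apply: HA; rewrite /Addr sub.
  + by move=> a Ha; apply: HL; rewrite sub.
  + move=> a b Ha Hb.
    have Hc c : Addr (nth Leaf ts k) c -> Addr (Node ts) (1 + k :: c) by rewrite /Addr sub.
    by have := HP _ _ (Hc _ Ha) (Hc _ Hb); rewrite /= eqxx.
- have N i j : i < size ts -> j < size ts -> i <> j -> ~~ prefix (f [:: 1 + i]) (f [:: 1 + j]).
    move=> Hi Hj ne; apply/negP => /(HP _ _ (Hchild _ Hi) (Hchild _ Hj)) /andP[/eqP]; lia.
  by move=> k l /andP[lt1 lt2]; apply/andP; split; apply: N; lia.
have [u Hu Hin] := Addr_nodes (HA [::] ltac:(by [])).
rewrite Hw in Hin.
apply: (column_mem Hin Hrest).
apply/allP => r /mapP[j]; rewrite mem_iota => /andP[lt1 lt2] ->.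
have Hj : Addr (Node ts) [:: j].
  by have := Hchild j.-1; rewrite add1n prednK //; apply; lia.
have H0 : Addr (Node ts) [::] by [].
apply/andP; split; first by rewrite -Hw; apply/(HP _ _ H0 Hj).
by apply/negP; rewrite -Hw => /(HP _ _ Hj H0).
Qed.

(** A hit with an empty image list looks like no hit, hence the form of the second alternative; such
    hits are excluded afterwards, since embedding lists are nonempty. *)
Lemma root_images_spec (P : seq item) : (exists2 x, x \in P & nilp (head [::] x.1) /\ root_images P = x.2) \/
  (root_images P = [::] /\ forall x, x \in P -> nilp (head [::] x.1) -> x.2 = [::]).
Proof.
rewrite /root_images; elim/last_ind: P => [|P y IH]; first by right.
rewrite foldl_rcons; set acc := foldl _ _ P in IH *; rewrite /root_images_step.
case: ifP => [/andP[H1 H2]|H].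
  by left; exists y; rewrite // mem_rcons mem_head.
case: IH => [[x Hx Ex]|[E IH]].
  by left; exists x => //; rewrite mem_rcons in_cons Hx orbT.
right; split=> // x; rewrite mem_rcons in_cons => /orP[/eqP ->|/IH //].
by rewrite E /= in H; rewrite H.
Qed.

Lemma root_images_correct t1 :
  let L := root_images (join_items (embedding_lists ns t1) init_items) in
  (nilp L /\ ~ embeds t1 t2) \/
  [/\ ~~ nilp L, size L = size (addrs t1) & is_embedding t1 t2 (list_fun t1 L)].
Proof.
move=> L0; have Hmem x : x \in join_items (embedding_lists ns t1) init_items <->
    exists2 L, L \in embedding_lists ns t1 & x = ([:: head [::] L], L).
  split.
    case/mem_join_items=> L HL [y]; rewrite inE => /eqP -> [_ ->] /=.
    by exists L; rewrite ?cats0.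
  case=> L HL ->; apply/mem_join_items; exists L => //; exists ([::], [::]) => //.
  by rewrite cats0.
have Hsize L : L \in embedding_lists ns t1 -> ~~ nilp L.
  case/embedding_lists_sound=> + _ _ _; case: (t1) => [|ts]; first by case: L.
  by rewrite addrs_Node; case: L.
case: (root_images_spec (join_items (embedding_lists ns t1) init_items)).
  case=> x /Hmem [L HL -> /=] [/nilP Hhd]; rewrite -/L0 => ->; right.
  have [sL AL LL PL] := embedding_lists_sound HL.
  have Hz a : Addr t1 a -> (a, list_fun t1 L a) \in zip (addrs t1) L.
    move/mem_addrs=> Ha; have lt : index a (addrs t1) < size (addrs t1) by rewrite index_mem.
    have -> : (a, list_fun t1 L a) = nth ([::], [::]) (zip (addrs t1) L) (index a (addrs t1)).
      by rewrite nth_zip // nth_index.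
    by rewrite mem_nth // size_zip sL minnn.
  split=> //; first exact: Hsize.
  split.
  - by move=> a /Hz /AL.
  (* Equal images are prefixes of each other, hence so are the addresses. *)
  - move=> a b Ha Hb E; apply: prefix_asym.
      by rewrite (PL _ _ _ _ (Hz _ Ha) (Hz _ Hb)) E prefix_refl.
    by rewrite (PL _ _ _ _ (Hz _ Hb) (Hz _ Ha)) E prefix_refl.
  - by rewrite -[RHS]Hhd /list_fun; case: (t1) => [|ts]; rewrite ?addrs_Node /= nth0.
  - move=> a Ha; apply: LL (Ha); apply: Hz; by rewrite /Addr Ha.
  - by move=> a b Ha Hb; rewrite (PL _ _ _ _ (Hz _ Ha) (Hz _ Hb)).
case=> E H; left; split; first by rewrite /L0 E.
case=> f [HA _ H0 HL HP].
have [L HinL Hhd] := embedding_lists_complete (And4 HA H0 HL HP).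
have /H /= EL : ([:: head [::] L], L) \in join_items (embedding_lists ns t1) init_items.
  by apply/Hmem; exists L.
by have := Hsize _ HinL; rewrite EL // Hhd.
Qed.
End Correctness.

(** * Sizes of the intermediate values *)

Lemma code_syms t : all (mem [:: SLeaf; SOpen; SClose]) (code t).
Proof.
elim/Topo_nth_ind: t => // ts IH; rewrite code_Node /= all_rcons /=.
elim: ts IH => //= t ts IHts IH; rewrite all_cat (IH 0) //=.
by apply: IHts => i; apply: (IH i.+1).
Qed.

Lemma deg_le_Node d ts : deg_le d (Node ts) = (size ts <= d) && all (deg_le d) ts.
Proof. by rewrite /=; congr (_ && _); elim: ts => //= t ts ->. Qed.

Lemma input_syms t1 t2 : all input_sym (input t1 t2).
Proof.
have H t : all input_sym (code t) by apply: sub_all (code_syms t) => -[].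
by rewrite /input all_cat /= !H.
Qed.

Definition str_node (w : node) : seq bool * bool := (addr_str w.1, w.2).

Lemma parse_first t u r k o : foldl parse_step (u, false, r, k, o) (code t) =
  (rev (code t) ++ u, false, r, k, o).
Proof.
elim: (code t) u (code_syms t) => //= s w IH u /andP[Hs Hw].
have -> : s == SSep = false by case: s Hs.
by rewrite IH // rev_cons cat_rcons.
Qed.

Lemma next_sibling_rcons p i :
  next_sibling (rev (addr_str (rcons p i))) = rev (addr_str (rcons p i.+1)).
Proof. by rewrite !addr_str_rcons !rev_cat !rev_rcons !rev_nseq. Qed.

(** A complete subtree leaves the stack of ancestors as it was and advances the address to the next
    sibling, which is the state in which the next tree of a forest has to be read. *)
Lemma parse_second t p u k o :
  foldl parse_step (u, true, rev (addr_str p), k, o) (code t) =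
  (u, true, next_sibling (rev (addr_str p)), k, map str_node (nodes_at p t) ++ o).
Proof.
elim/Topo_nth_ind: t p u k o => [|ts IH] p u k o; first by rewrite /= revK.
rewrite code_Node nodes_at_Node /= foldl_rcons revK.
have -> : false :: true :: rev (addr_str p) = rev (addr_str (rcons p 1)).
  by rewrite addr_str_rcons rev_cat.
have Hf us i k' o' : (forall j, j < size us -> forall p u k o,
    foldl parse_step (u, true, rev (addr_str p), k, o) (code (nth Leaf us j)) =
    (u, true, next_sibling (rev (addr_str p)), k, map str_node (nodes_at p (nth Leaf us j)) ++ o)) ->
  foldl parse_step (u, true, rev (addr_str (rcons p i)), k', o') (forest_code us) =
  (u, true, rev (addr_str (rcons p (i + size us))), k',
   map str_node (forest_nodes p i us) ++ o').
  elim: us i o' => [|v us IHus] i o' H; first by rewrite addn0.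
  rewrite /forest_code /= foldl_cat (H 0 isT) /= next_sibling_rcons.
  rewrite IHus; last by move=> j; apply: (H j.+1).
  by rewrite map_cat -catA addSnnS.
by rewrite Hf //= map_rcons cat_rcons.
Qed.

Definition parse_init : pstate := ([::], false, [::], [::], [::]).

Lemma parse_input t1 t2 : exists r, foldl parse_step parse_init (input t1 t2) =
  (rev (code t1), true, r, [::], map str_node (nodes_at [::] t2)).
Proof.
rewrite /input foldl_cat parse_first /= cats0.
by rewrite -[X in (_, _, X, _, _)]/(rev (addr_str [::])) parse_second cats0; eexists.
Qed.

Lemma sz_enc_list (T : eqType) (f : T -> tree) l c :
  (forall x, x \in l -> sz (f x) <= c) -> sz (enc_list f l) <= size l * c.+1 + 1.
Proof.
elim: l => //= x l IH H; rewrite sz_Cn.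
have := H x (mem_head _ _); have := IH (fun y Hy => H y (mem_behead (s := x :: l) Hy)); lia.
Qed.

Lemma sz_enc_str s : sz (enc_str s) = 2 * size s + 1.
Proof. by elim: s => //= b s IH; rewrite sz_Cn IH; case: b; rewrite /sz /=; lia. Qed.

(** Here [n] counts the symbols read. One symbol lengthens an address string by at most two
    booleans, a digit and an end mark; hence [2 * n]. *)
Definition parse_inv (n : nat) (x : pstate) : Prop :=
  let: (u, m, r, k, o) := x in
  [/\ size u <= n, size r <= 2 * n, size k <= n /\ (forall s : seq bool, s \in k -> size s <= 2 * n)
    & size o <= n /\ forall w : seq bool * bool, w \in o -> size w.1 <= 2 * n].

Lemma parse_inv_step n x s : parse_inv n x -> parse_inv n.+1 (parse_step x s).
Proof.
case: x => [[[[u m] r] k] o] [Hu Hr [Hk Hk'] [Ho Ho']].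
have Hnext t : size t <= 2 * n -> size (next_sibling t) <= 2 * n.+1.
  by rewrite /next_sibling /= size_behead; lia.
have Hkn : forall t : seq bool, t \in k -> size t <= 2 * n.+1 by move=> t /Hk'; lia.
have Hon : forall w : seq bool * bool, w \in o -> size w.1 <= 2 * n.+1 by move=> w /Ho'; lia.
have Hoo b : forall w : seq bool * bool, w \in (rev r, b) :: o -> size w.1 <= 2 * n.+1.
  by move=> w; rewrite in_cons => /orP[/eqP ->|/Hon //] /=; rewrite size_rev; lia.
rewrite /parse_step; case: m; case: (s == _) => /=.
- by split; [lia | exact: Hnext | split=> //; lia | split; [rewrite /=; lia | exact: Hoo]].
- case: (s == SOpen).
    split; [lia | rewrite /=; lia | | by split; [rewrite /=; lia | exact: Hoo]].
    split=> [|t]; first by rewrite /=; lia.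
    by rewrite in_cons => /orP[/eqP ->|/Hkn //]; lia.
  split; [lia | | | by split=> //; lia].
    by apply: Hnext; case: (k) Hk' => //= t k' H; apply: H; rewrite mem_head.
  by split=> [|t Ht]; [rewrite size_behead; lia | apply: Hkn; apply: mem_behead].
- by split; [lia | lia | split=> //; lia | split=> //; lia].
- by split; [rewrite /=; lia | lia | split=> //; lia | split=> //; lia].
Qed.

Lemma sz_parse_inv n x : parse_inv n x -> sz (enc_pstate x) <= 20 * n * n + 40 * n + 40.
Proof.
case: x => [[[[u m] r] k] o] [Hu Hr [Hk Hk'] [Ho Ho']].
have H1 : sz (enc_list enc_sym u) <= size u * 2 + 1.
  by apply: sz_enc_list => s _; rewrite /sz.
have H2 : sz (enc_list enc_str k) <= size k * (4 * n + 1).+1 + 1.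
  by apply: sz_enc_list => s /Hk'; rewrite sz_enc_str; lia.
have H3 : sz (enc_list enc_snode o) <= size o * (4 * n + 3).+1 + 1.
  apply: sz_enc_list => s /Ho'; rewrite sz_Cn sz_enc_str => ?.
  by have -> : sz (enc_bool s.2) = 1 by []; lia.
rewrite /= !sz_Cn sz_enc_str; have -> : sz (enc_bool m) = 1 by [].
by nia.
Qed.

Lemma parse_inv_foldl n x w : parse_inv n x -> parse_inv (n + size w) (foldl parse_step x w).
Proof.
elim: w n x => [|s w IH] n x H /=; first by rewrite addn0.
by rewrite addnS -addSn; apply: IH; apply: parse_inv_step.
Qed.

Lemma parse_acc_le e M w n x : all input_sym w -> parse_inv n x ->
  20 * (n + size w) * (n + size w) + 40 * (n + size w) + 40 <= M ->
  acc_le (fun s => parse_step_t (hd (hd s)) (tl (hd s)) (tl s)) e M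
    (enc_pstate x) (enc_list enc_sym w).
Proof.
elim: w n x => [|s w IH] n x /=; first by move=> _ /sz_parse_inv; rewrite addn0; lia.
case/andP=> Hs Hw Hx le; split; first by have := sz_parse_inv Hx; nia.
rewrite parse_step_enc //; apply: (IH n.+1) => //; first exact: parse_inv_step.
by rewrite addSnnS.
Qed.

Lemma forest_code_cons t ts : forest_code (t :: ts) = code t ++ forest_code ts.
Proof. by []. Qed.

Lemma size_addrs t : size (addrs t) <= size (code t).
Proof.
elim/Topo_nth_ind: t => // ts IH; rewrite addrs_Node code_Node /= size_rcons.
suff H : size (forest_addrs 1 ts) <= size (forest_code ts) by rewrite ltnS; apply: leqW.
elim: ts 1 IH => //= t ts IHts i IH; rewrite size_cat size_map forest_code_cons size_cat.
by apply: leq_add; [apply: (IH 0) | apply: IHts => k; apply: (IH k.+1)].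
Qed.

Lemma size_forest_addrs i ts : size (forest_addrs i ts) <= size (forest_code ts).
Proof.
elim: ts i => //= t ts IH i; rewrite size_cat size_map forest_code_cons size_cat.
by rewrite leq_add // size_addrs.
Qed.

Lemma foldl_col_forest ns ts Q st :
  (forall k, k < size ts -> forall P st, foldl (col_step ns) (P :: st) (rev (code (nth Leaf ts k))) =
     join_items (embedding_lists ns (nth Leaf ts k)) P :: st) ->
  foldl (col_step ns) (Q :: st) (rev (forest_code ts)) =
    foldr (fun u P => join_items (embedding_lists ns u) P) Q ts :: st.
Proof.
elim: ts => //= t ts IH H; rewrite forest_code_cons rev_cat foldl_cat IH.
  by rewrite (H 0).
by move=> k; apply: (H k.+1).
Qed.

(** Read backwards, the closing symbol of a node starts a fresh item list, the children are joined
    into it, and the opening symbol turns it into a column that is joined to [P]. *)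
Lemma foldl_col ns t P st : foldl (col_step ns) (P :: st) (rev (code t)) =
  join_items (embedding_lists ns t) P :: st.
Proof.
elim/Topo_nth_ind: t P st => // ts IH P st.
rewrite code_Node rev_cons rev_rcons foldl_rcons /=.
by rewrite foldl_col_forest.
Qed.

Lemma foldl_col_items ns ts st : foldl (col_step ns) (init_items :: st) (rev (forest_code ts)) =
  forest_items ns ts :: st.
Proof. by rewrite foldl_col_forest // => *; rewrite foldl_col. Qed.

Section Sizes.
Variables (t2 : Topo) (d n : nat).
Let ns := nodes_at [::] t2.
Hypothesis ns_size : size ns <= n.
Hypothesis ns_str : forall w, w \in ns -> size (addr_str w.1) <= 2 * n.

Lemma size_embedding_lists t : size (embedding_lists ns t) <= n.
Proof.
apply: leq_trans ns_size; rewrite -[size ns]muln1.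
case: t => [|ts]; apply: size_flatmap_le => w; first by case: w.2.
by rewrite /place; case: (filter _ _).
Qed.

Lemma size_forest_items ts : size (forest_items ns ts) <= n ^ size ts.
Proof.
elim: ts => //= t ts IH; rewrite expnS.
apply: leq_trans (leq_mul (size_embedding_lists t) IH).
apply: size_flatmap_le => L; rewrite -[X in _ <= X]muln1.
by apply: size_flatmap_le => x; rewrite /extend; case: ifP.
Qed.

Lemma sz_address a : Addr t2 a -> sz (enc_address a) <= 4 * n + 1.
Proof.
by case/Addr_nodes=> u _ /ns_str /=; rewrite sz_enc_str; lia.
Qed.

(** Soundness bounds the item: [x.2] has one address of [t2] for each node of the forest and [x.1]
    one for each of its trees, and an address of [t2] takes at most [4 * n + 1] symbols. *)
Lemma sz_item ts x : x \in forest_items ns ts ->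
  sz (enc_item x) <= (size ts + size (forest_code ts)) * (4 * n + 2) + 3.
Proof.
move=> Hx.
have Hsound k : k < size ts -> forall L, L \in embedding_lists ns (nth Leaf ts k) ->
   good_images t2 (addrs (nth Leaf ts k)) (fun a => subtree (nth Leaf ts k) a = Some Leaf) L.
  by move=> _ L; apply: embedding_lists_sound.
have [[s2 A2 _ _] _] := forest_items_sound 1 Hsound Hx.
have Hin A (L : seq addr) b : size L = size A -> b \in L -> exists a : addr, (a, b) \in zip A L.
  move=> E Hb; have : b \in unzip2 (zip A L) by rewrite unzip2_zip ?E.
  by case/mapP=> -[a c] H /= ->; exists a.
have H2 : forall b, b \in x.2 -> sz (enc_address b) <= 4 * n + 1.
  by move=> b /(Hin _ _ _ s2) [a /A2]; apply: sz_address.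
have [s1 H1] : size x.1 = size ts /\ forall b, b \in x.1 -> sz (enc_address b) <= 4 * n + 1.
  elim: (ts) x {s2 A2 H2 Hsound} Hx => [|t us IH] x; first by rewrite inE => /eqP ->.
  case/mem_join_items=> L HL [y Hy [_ ->]] /=.
  have [-> Hy'] := IH _ Hy; split=> // b; rewrite in_cons => /orP[/eqP ->|/Hy' //].
  have [sL AL _ _] := embedding_lists_sound HL.
  apply: sz_address; apply: (AL (head [::] (addrs t))).
  have H0 : [::] \in addrs t by apply/mem_addrs.
  by case: (addrs t) (L) sL H0 => [|a A] [|l L'] //= _ _; rewrite mem_head.
have E1 := sz_enc_list H1; have E2 := sz_enc_list H2.
rewrite sz_Cn /enc_addrs; rewrite s1 in E1; rewrite s2 in E2.
have := leq_mul (size_forest_addrs 1 ts) (leqnn (4 * n + 1).+1) => le.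
rewrite mulnDl; have -> : 4 * n + 2 = (4 * n + 1).+1 by lia.
by apply: leq_ltn_trans (leq_add E1 (leq_trans E2 (leq_add le (leqnn 1)))) _; lia.
Qed.

(** The bound [d.+1] leaves room for adding one tree to a list of at most [d]; for [d = 0] this is
    already needed at the root, which is itself joined to [init_items]. *)
Definition good_items (P : seq item) : Prop :=
  exists us, [/\ P = forest_items ns us, size us <= d.+1 & size (forest_code us) <= n].

Definition good_stack (st : seq (seq item)) : Prop :=
  size st <= n + 2 /\ forall P, P \in st -> good_items P.

(** Number of items times the bound of [sz_item], increased by one for the pair that links an item
    into the list. The base [n.+1] is positive, so the power is monotone in the exponent. *)
Definition items_bound : nat := n.+1 ^ d.+1 * ((d.+1 + n) * (4 * n + 2) + 4) + 1.
Definition stack_bound : nat := (n + 2) * items_bound.+1 + 1.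

Lemma sz_good_stack st : good_stack st -> sz (enc_stack st) <= stack_bound.
Proof.
case=> Hsz Hst; have : sz (enc_stack st) <= size st * items_bound.+1 + 1.
  apply: sz_enc_list => P /Hst [us [-> s1 s2]].
  have := @sz_enc_list _ enc_item (forest_items ns us) ((d.+1 + n) * (4 * n + 2) + 3).
  have -> : forall m, (m + 3).+1 = m + 4 by lia.
  move=> H; apply: (leq_trans (H _)).
    by move=> x /sz_item le; apply: leq_trans le _; rewrite leq_add2r leq_mul2r leq_add ?orbT.
  rewrite /items_bound leq_add2r leq_mul2r; apply/orP; right.
  apply: leq_trans (size_forest_items us) _.
  apply: leq_trans (leq_pexp2l (ltn0Sn n) s1).
  by case: (size us) => // k; rewrite leq_exp2r.
by rewrite /stack_bound; nia.
Qed.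

Fixpoint states_ok (st : seq (seq item)) (w : seq sym) : Prop :=
  good_stack st /\ (if w is s :: w' then states_ok (col_step ns st s) w' else True).

Lemma states_ok_cat st w1 w2 : states_ok st w1 -> states_ok (foldl (col_step ns) st w1) w2 ->
  states_ok st (w1 ++ w2).
Proof. by elim: w1 st => [|s w1 IH] st //= [H1 H2] H; split=> //; apply: IH. Qed.

Lemma good_push (P : seq item) (st : seq (seq item)) : good_items P -> size st <= n.+1 -> (forall Q, Q \in st -> good_items Q) ->
  good_stack (P :: st).
Proof.
move=> HP Hs Hst; split; first by rewrite /= addn2 ltnS.
by move=> Q; rewrite in_cons => /orP[/eqP ->|/Hst].
Qed.

(** The depth of the stack is controlled by [size st + size (code t) <= n.+1]: entering a node adds
    one stack entry and uses up two symbols, its brackets. *)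
Lemma states_ok_code t us (st : seq (seq item)) : deg_le d t -> size us <= d ->
  size (forest_code (t :: us)) <= n -> (forall P : seq item, P \in st -> good_items P) ->
  size st + size (code t) <= n.+1 ->
  states_ok (forest_items ns us :: st) (rev (code t)).
Proof.
elim/Topo_nth_ind: t us st => [|ts IH] us st Hdeg Hus Hcode Hst Hsize.
  have Hus' : good_items (forest_items ns us).
    exists us; split=> //; first exact: leqW.
    by apply: leq_trans Hcode; rewrite forest_code_cons size_cat leq_addl.
  have Hus1 : good_items (forest_items ns (Leaf :: us)) by exists (Leaf :: us).
  by split; [|split=> //]; apply: good_push => //; apply: leq_trans (leq_addr _ _) Hsize.
have Hus' : good_items (forest_items ns us).
  exists us; split=> //; first exact: leqW.
  by apply: leq_trans Hcode; rewrite forest_code_cons size_cat leq_addl.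
have Hus1 : good_items (forest_items ns (Node ts :: us)) by exists (Node ts :: us).
rewrite deg_le_Node in Hdeg; case/andP: Hdeg => Hts Hall.
rewrite forest_code_cons code_Node /= size_cat size_rcons in Hcode.
rewrite code_Node /= size_rcons in Hsize.
have Hst' : forall P, P \in forest_items ns us :: st -> good_items P.
  by move=> P; rewrite in_cons => /orP[/eqP ->|/Hst].
rewrite code_Node rev_cons rev_rcons -cats1 cat_cons; split.
  by apply: good_push => //; lia.
have Hf : forall vs, (forall k, k < size vs -> forall us st,
    deg_le d (nth Leaf vs k) -> size us <= d ->
    size (forest_code (nth Leaf vs k :: us)) <= n ->
    (forall P : seq item, P \in st -> good_items P) ->
    size st + size (code (nth Leaf vs k)) <= n.+1 ->
    states_ok (forest_items ns us :: st) (rev (code (nth Leaf vs k)))) ->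
  size vs <= d -> all (deg_le d) vs -> size (forest_code vs) <= n ->
  size (forest_items ns us :: st) + size (forest_code vs) <= n.+1 ->
  states_ok (init_items :: forest_items ns us :: st) (rev (forest_code vs)).
  elim=> [|v vs IHvs] H Hvs Hdeg Hn Hsz.
    split=> //; apply: good_push => //; last by move: Hsz => /=; lia.
    by exists [::].
  move: Hdeg => /= /andP[Hv Hvs'].
  rewrite forest_code_cons size_cat in Hn Hsz.
  rewrite forest_code_cons rev_cat; apply: states_ok_cat.
    apply: IHvs => //; try lia.
    - by move=> k; apply: (H k.+1).
    - by move: Hvs => /=; lia.
  rewrite foldl_col_items; apply: (H 0) => //; first exact: ltnW.
    by rewrite forest_code_cons size_cat.
  by apply: leq_trans Hsz; rewrite leq_add2l leq_addr.
apply: states_ok_cat.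
  by apply: Hf => //=; lia.
rewrite foldl_col_items; split.
  apply: good_push => //; last by rewrite /=; lia.
  by exists ts; split=> //; lia.
by split=> //; apply: good_push => //; apply: leq_trans (leq_addr _ _) Hsize.
Qed.

Lemma states_ok_acc_le st w : states_ok st w ->
  acc_le (fun s => col_step_t (hd (hd s)) (tl (hd s)) (tl s)) (enc_list enc_node ns) stack_bound
    (enc_stack st) (enc_list enc_sym w).
Proof.
elim: w st => [|s w IH] st /= [H1 H2]; split=> //; try exact: sz_good_stack.
by rewrite col_step_enc; apply: IH.
Qed.
End Sizes.

(** * The machine *)

Definition solution (t1 t2 : Topo) : seq addr :=
  root_images (join_items (embedding_lists (nodes_at [::] t2) t1) init_items).

Lemma foldG_parse e x w : all input_sym w ->
  foldG parse_step_t e (enc_pstate x) (enc_list enc_sym w) = enc_pstate (foldl parse_step x w).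
Proof.
by elim: w x => //= s w IH x /andP[Hs Hw]; rewrite parse_step_enc // IH.
Qed.

Lemma foldG_col ns st w :
  foldG col_step_t (enc_list enc_node ns) (enc_stack st) (enc_list enc_sym w) =
  enc_stack (foldl (col_step ns) st w).
Proof. by elim: w st => //= s w IH st; rewrite col_step_enc IH. Qed.

Lemma sz_enc_syms w : sz (enc_list enc_sym w) = 2 * size w + 1.
Proof. by elim: w => //= s w IH; rewrite sz_Cn IH /sz /=; lia. Qed.

Lemma pol_stack_bound d : pol (stack_bound d).
Proof.
rewrite /stack_bound /items_bound.
have E : (fun n => (n + 2) * (n.+1 ^ d.+1 * ((d.+1 + n) * (4 * n + 2) + 4) + 1).+1 + 1) =1
   (fun n => (n + 2) * ((n + 1) ^ d.+1 * ((d.+1 + n) * (4 * n + 2) + 4) + 2) + 1).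
  by move=> n; rewrite -(addn1 n) -[(_ + 1).+1]addn1 -!addnA.
have [mono [c [k H]]] : pol (fun n => (n + 2) * ((n + 1) ^ d.+1 * ((d.+1 + n) * (4 * n + 2) + 4) + 2) + 1).
  by pol_tac.
split=> [m n le|]; first by rewrite !E; apply: mono.
by exists c, k => n; rewrite E.
Qed.

(** The two main folds have no [PT] statement, since their accumulators are bounded only on genuine
    inputs with the degree bound or the parser invariant; they are run through [foldG_runs] between
    three unconditional [PT] stages. *)
Lemma solve_runs : exists p, forall d, exists Q, pol Q /\ forall t1 t2, deg_le d t1 ->
  runs p (enc_list enc_sym (input t1 t2)) (enc_list At (answer_atoms (solution t1 t2)))
    (Q (size (input t1 t2))).
Proof.
(* This is the tree of [parse_init]: empty lists, empty strings and the flag [false] are all encoded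
   by [tnil]. *)
pose e0 := Cn tnil (Cn tnil (Cn tnil (Cn tnil tnil))).
have [p1 [q1 [Hq1 H1]]] : PT (fun d => Cn (Cn tnil e0) d) by rewrite /e0; pt.
have [p2 [q2 [Hq2 H2]]] := foldG_runs PT3_parse_step.
have [p3 [q3 [Hq3 H3]]] : PT (fun s => Cn (Cn (tl (tl (tl (tl s)))) (enc_stack [:: init_items])) (hd s)).
  by rewrite /enc_stack /=; pt.
have [p4 [q4 [Hq4 H4]]] := foldG_runs PT3_col_step.
have [p5 [q5 [Hq5 H5]]] : PT (fun s => answer_t (root_images_t (hd s))).
  by apply: PT_answer; apply: PT_root_images; pt.
exists (SSeq (SSeq (SSeq (SSeq p1 p2) p3) p4) p5) => d.
pose M1 n := 20 * n * n + 40 * n + 40.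
have HM1 : pol M1 by rewrite /M1; pol_tac.
have HM2 := pol_stack_bound d; set M2 := stack_bound d in HM2.
exists (fun n => q1 (2 * n + 1) + q2 (1 + M1 n + (2 * n + 1)) + q3 (M1 n) +
  q4 (M1 n + M2 n + (2 * n + 1)) + q5 (M2 n)); split.
  do !apply: pol_add.
  - by apply: (pol_comp Hq1); pol_tac.
  - by apply: (pol_comp Hq2); do 2 apply: pol_add => //; pol_tac.
  - exact: (pol_comp Hq3).
  - by apply: (pol_comp Hq4); do 2 apply: pol_add => //; pol_tac.
  - exact: (pol_comp Hq5).
move=> t1 t2 Hdeg; set w := input t1 t2; set n := size w.
have Hw : all input_sym w := input_syms t1 t2.
have Einit : e0 = enc_pstate parse_init by [].
have inv0 : parse_inv 0 parse_init by [].
have inv1 := parse_inv_foldl w inv0; rewrite add0n -/n in inv1.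
have [r Hparse] := parse_input t1 t2; rewrite -/w in Hparse.
set ns := nodes_at [::] t2 in Hparse.
have szp := sz_parse_inv inv1.
have R1 := H1 (enc_list enc_sym w); rewrite sz_enc_syms -/n Einit in R1.
have R2 := H2 tnil (enc_pstate parse_init) (enc_list enc_sym w) (M1 n)
  (@parse_acc_le tnil (M1 n) w 0 parse_init Hw inv0 (leqnn _)).
rewrite foldG_parse // sz_enc_syms -/n in R2.
have R3 := runs_le (H3 (enc_pstate (foldl parse_step parse_init w))) (proj1 Hq3 _ _ szp).
rewrite Hparse in inv1 szp R2 R3.
case: inv1 => Hu _ _ [Ho Ho'].
have ns_size : size ns <= n by rewrite size_map in Ho.
have ns_str : forall v, v \in ns -> size (addr_str v.1) <= 2 * n.
  by move=> v Hv; apply: (Ho' (str_node v)); apply: map_f.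
have Ens : enc_list enc_snode (map str_node ns) = enc_list enc_node ns by rewrite enc_list_map.
rewrite /= Ens in R3; rewrite [enc_pstate (rev _, _, _, _, _)]/= Ens in R2.
have sz_ns : sz (enc_list enc_node ns) <= M1 n.
  apply: leq_trans szp; rewrite /= Ens !sz_Cn; lia.
have size1 : size (forest_code [:: t1]) <= n.
  by rewrite /forest_code /= cats0 /n /w /input size_cat leq_addr.
have ok : states_ok t2 d n [:: init_items] (rev (code t1)).
  apply: (@states_ok_code t2 d n ns_size t1 [::] [::]) => //=.
  by apply: leqW; apply: leq_trans size1; rewrite /forest_code /= cats0.
have Hacc := states_ok_acc_le ns_size ns_str ok.
have R4 := H4 _ _ _ _ Hacc; rewrite -/ns foldG_col foldl_col sz_enc_syms in R4.
have ok' : good_stack t2 d n (foldl (col_step ns) [:: init_items] (rev (code t1))).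
  elim: (rev _) [:: init_items] ok => [|s v IH] st /= [? ?] //; exact: IH.
have szs := sz_good_stack ns_size ns_str ok'; rewrite foldl_col in szs.
have R5 := runs_le (H5 _) (proj1 Hq5 _ _ szs).
rewrite [hd _]/= root_images_enc -/(solution t1 t2) answer_enc in R5.
have mono4 : q4 (sz (enc_list enc_node ns) + M2 n + (2 * size (rev (code t1)) + 1)) <=
    q4 (M1 n + M2 n + (2 * n + 1)).
  by apply: (proj1 Hq4); lia.
exact: (runs_seq (runs_seq (runs_seq (runs_seq R1 R2) R3) (runs_le R4 mono4)) R5).
Qed.

(** The Polish code of a list of atoms is the atoms, each preceded by [SOne], with a final [SLeaf].
    Pushing builds it from its end, so the word is first reversed onto stack B. *)
Definition in_prog : sprog :=
  SSeq (SSeq (flush StkA (SPush StkB id)) (push_sym StkA SLeaf))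
    (flush StkB (SSeq (SPush StkA id) (push_sym StkA SOne))).

Definition out_sym (s : sym) : sym := if s == SOpen then SOne else s.

Definition out_loop : sprog :=
  SWhile (eq_op^~ SOne) (SSeq (SSeq (SPop StkA) (SPush StkB out_sym)) (SPop StkA)).

Definition out_prog : sprog :=
  SSeq (SPop StkA) (SIf (eq_op^~ SOne) (SSeq out_loop (flush StkB (SPush StkA id)))
    (push_sym StkA SOpen)).

Lemma polish_enc_syms w : all input_sym w ->
  polish (enc_list enc_sym w) = flatten [seq [:: SOne; s] | s <- w] ++ [:: SLeaf].
Proof.
elim: w => //= s w IH /andP[Hs /IH ->].
by case: s Hs.
Qed.

Lemma in_run N w r n : all input_sym w -> 2 * size w + 2 <= N -> 10 * size w + 10 <= n ->
  exists r', srun N in_prog r (w, [::], [::], [::]) n r' (sA (polish (enc_list enc_sym w))).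
Proof.
move=> Hw leN len.
have Hs : all stack_sym w by apply: sub_all Hw => -[].
exists Blank; rewrite polish_enc_syms //.
have szf (m : seq sym) : size (flatten [seq [:: SOne; s] | s <- m]) = 2 * size m.
  by elim: m => //= s m ->; lia.
have H1 : srun N (flush StkA (SPush StkB id)) r (w, [::], [::], [::]) (4 * size w + 3)
    Blank ([::], rev w, [::], [::]).
  have := @flush_run N StkA (SPush StkB id) (fun w m => (w, m, [::], [::])) w [::] 1 (4 * size w + 3) r.
  rewrite cats0; apply=> //.
  - by move=> w' _ m' le2 /=; rewrite /= in le2; lia.
  - by move=> x w' m' le2 Hx Hx'; rewrite /= in le2; apply: RunPush => //=; lia.
apply: (@RunSSeq _ _ _ _ _ Blank ([:: SLeaf], rev w, [::], [::]) _ _ (4 * size w + 4) (5 * size w + 4)); last by lia.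
  apply: (RunSSeq H1 (n2 := 1)); last by lia.
  by apply: RunPush => //=; rewrite size_rev; lia.
have := @flush_run N StkB (SSeq (SPush StkA id) (push_sym StkA SOne))
  (fun w m => (flatten [seq [:: SOne; s] | s <- m] ++ [:: SLeaf], w, [::], [::]))
  (rev w) [::] 2 (5 * size w + 4) Blank.
rewrite revK cats0; apply=> //.
- by move=> w' le1 m' le2 /=; rewrite size_rev /= in le1 le2; rewrite size_cat szf /=; lia.
- move=> x w' m' le2 Hx Hx'; rewrite size_rev /= in le2.
  apply: (@RunSSeq _ _ _ _ _ x (x :: flatten [seq [:: SOne; s] | s <- m'] ++ [:: SLeaf], w', [::], [::]) _ _ 1 1) => //;
  by apply: RunPush => //=; rewrite size_cat szf /=; lia.
- by rewrite all_rev.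
- by rewrite size_rev; lia.
Qed.

Lemma sz_enc_atoms l : sz (enc_list At l) = 2 * size l + 1.
Proof. by elim: l => //= a l IH; rewrite sz_Cn IH /sz /=; lia. Qed.

Lemma out_loop_run N l b : sz (enc_list At l) + size b <= N ->
  srun N out_loop (head_sym (enc_list At l)) (behead (polish (enc_list At l)), b, [::], [::])
    (4 * size l + 1) SLeaf ([::], rev (map atom_out l) ++ b, [::], [::]).
Proof.
rewrite sz_enc_atoms.
elim: l b => [|a l IH] b leN /=; first exact: RunSWhileF.
have szl := sz_enc_atoms l; rewrite /sz in szl.
rewrite /= in leN.
apply: (@RunSWhileT _ _ _ _ _ (head_sym (enc_list At l))
  (behead (polish (enc_list At l)), atom_out a :: b, [::], [::]) _ _ 3 (4 * size l + 1)) => //.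
- apply: (@RunSSeq _ _ _ _ _ (atom_sym a) (polish (enc_list At l), atom_out a :: b, [::], [::]) _ _ 2 1) => //.
    apply: (@RunSSeq _ _ _ _ _ (atom_sym a) (polish (enc_list At l), b, [::], [::]) _ _ 1 1) => //.
      by apply: RunPop => //=; lia.
    have -> : atom_out a = out_sym (atom_sym a) by case: a.
    by apply: RunPush => //=; [case: a | case: a | lia].
  by rewrite {1}polish_head; apply: RunPop => //=; rewrite size_behead; lia.
- by rewrite rev_cons cat_rcons; apply: IH => /=; lia.
- lia.
Qed.

(** [atom_out] never yields [SOpen], so this symbol is free to encode the negative answer until
    [final_sym] replaces it. *)
Definition out_word (l : seq atom) : seq sym := if nilp l then [:: SOpen] else map atom_out l.

Lemma out_run N l r n : sz (enc_list At l) <= N -> 20 * size l + 20 <= n ->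
  exists r', srun N out_prog r (sA (polish (enc_list At l))) n r'
    (out_word l, [::], [::], [::]).
Proof.
move=> leN len; have szl := sz_enc_atoms l.
case: l leN len szl => [|a l] leN len szl.
  exists SLeaf; apply: (@RunSSeq _ _ _ _ _ SLeaf (sA [::]) _ _ 1 2) => //; [exact: RunPop| | by lia].
  by apply: (@RunSIf _ _ _ _ _ _ _ _ 1) => //; apply: RunPush.
exists Blank; rewrite /out_word [nilp _]/=.
have szl' : size (polish (enc_list At (a :: l))) = 2 * size (a :: l) + 1 := szl.
apply: (@RunSSeq _ _ _ _ _ SOne (behead (polish (enc_list At (a :: l))), [::], [::], [::])
   _ _ 1 (10 * size (a :: l) + 10)); last by lia.
  by apply: RunPop => //; rewrite /sA /weight szl' -szl; rewrite !addn0.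
apply: (@RunSIf _ _ _ _ _ _ _ _ (10 * size (a :: l) + 9)); last by lia.
have H := @out_loop_run N (a :: l) [::] ltac:(by rewrite addn0).
rewrite cats0 in H; apply: (RunSSeq H (n2 := 4 * size (a :: l) + 3)); last by lia.
have := @flush_run N StkB (SPush StkA id) (fun w m => (m, w, [::], [::]))
  (rev (map atom_out (a :: l))) [::] 1 (4 * size (a :: l) + 3) SLeaf.
rewrite revK cats0; apply=> //.
- by move=> w' le1 m' le2; rewrite size_rev size_map /= in le2; rewrite /= in szl leN *; lia.
- move=> x w' m' le2 Hx Hx'; rewrite size_rev size_map /= in le2.
  by apply: RunPush => //=; rewrite /= in szl leN *; lia.
- by rewrite all_rev all_map; elim: (a :: l) => //= -[] v -> .
- by rewrite size_rev size_map; lia.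
Qed.

Lemma exec_le M n m (c cf : config M) : exec n c = Some cf -> n <= m -> exec m c = Some cf.
Proof.
elim: n m c => [|n IH] [|m] [q [[l h] r]] //=; case: (trans q h) => [[[q' s] mv]|] //.
by move=> H le; apply: IH.
Qed.

Theorem theorem6p2 (d : nat) :
  exists (M : TM) (c k : nat),
    forall t1 t2 : Topo, deg_le d t1 ->
      exists cf : config M,
        exec (c * (size (input t1 t2)).+1 ^ k) (init M (input t1 t2)) = Some cf /\
        ((output cf = enc_no /\ ~ embeds t1 t2) \/
         (exists L : seq (seq nat),
            [/\ output cf = enc_yes L, size L = size (addrs t1)
              & is_embedding t1 t2 (list_fun t1 L)])).
Proof.
have [p /(_ d) [Q [HQ Hp]]] := solve_runs.
have [M HM] := sprog_TM (SSeq (SSeq in_prog p) out_prog).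
(* [N] is the space for the input conversion and for [p]; [S] adds the times of input conversion,
   [p] and output conversion; [T] is the cost of simulating them on the tape as given by [sprog_TM],
   with an output of at most [Q n + 1] symbols. *)
pose N n := Q n + 2 * n + 2.
pose S n := 10 * n + 10 + Q n + (20 * Q n + 20).
pose T n := S n * (20 * N n + 110) + 4 * n + 4 * (Q n + 1) + 40.
have [_ [c [k Hck]]] : pol T by rewrite /T /S /N; pol_tac.
exists M, c, k => t1 t2 Hdeg.
set w := input t1 t2; set n := size w.
set L := solution t1 t2; set l := answer_atoms L.
have Hw : all input_sym w := input_syms t1 t2.
have [szl Hrun] := Hp t1 t2 Hdeg; rewrite -/w -/n -/L -/l in szl Hrun.
have szl' := sz_enc_atoms l.
have [r1 H1] := @in_run (N n) w Blank (10 * n + 10) Hw ltac:(rewrite /N; lia) (leqnn _).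
have [r2 H2] := Hrun [::] (N n) r1 ltac:(rewrite /N /=; lia).
rewrite !cats0 in H2.
have [r3 H3] := @out_run (N n) l r2 (20 * Q n + 20) ltac:(rewrite /N; lia) ltac:(lia).
have H := RunSSeq (RunSSeq H1 H2 (leqnn _)) H3 (leqnn _).
have Hs : all stack_sym w by apply: sub_all Hw => -[].
have [cf [Hexec Hout]] := HM _ _ _ _ _ Hs H.
exists cf; split.
  apply: (exec_le Hexec); apply: leq_trans (Hck n); rewrite /T /S -/n.
  have : size (out_word l) <= Q n + 1.
    by rewrite /out_word; case: ifP => //=; rewrite ?size_map; lia.
  by move: (_ * (20 * N n + 110)) => X; lia.
have final : map final_sym (out_word l) = if nilp l then enc_no else map atom_out l.
  rewrite /out_word; case: ifP => // _; rewrite -map_comp; apply: eq_map.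
  by case.
rewrite Hout final.
case: (root_images_correct t2 t1); rewrite -/(solution t1 t2) -/L.
  case=> HL no; left; split=> //.
  by rewrite /l /answer_atoms HL.
case=> HL sL emb; right; exists L; split=> //.
by rewrite -answer_atoms_enc // /l /answer_atoms (negbTE HL).
Qed.
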